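(* Let $(K,\partial)$ be a differential field of characteristic zero. Let $u_1,\ldots,u_n\in K\{x_1,\ldots,x_n\}$, let $I=[u_1,\ldots,u_n]\subseteq K\{x_1,\ldots,x_n\}$, and let $\Sigma=\operatorname{Spec}\big(K\{x_1,\ldots,x_n\}/I\big)$. Let $\Sigma_1$ be an irreducible component of $\Sigma$ such that $\Sigma_1$ is generically reduced and has finite dimension. Then $$\dim(\Sigma_1)\leq J(u_1,\ldots,u_n).$$
   Context: A differential ring is a commutative ring $R$ with an additive map $\partial:R\to R$ satisfying $\partial(ab)=\partial(a)b+a\partial(b)$; a differential field is a differential ring that is a field. $K\{x_1,\ldots,x_n\}=K[x_i^{(r)}: 1\le i\le n,\ r\ge 0]$ is the ring of differential polynomials: the polynomial ring in countably many variables with the unique derivation extending that of $K$ with $\partial x_i^{(r)}=x_i^{(r+1)}$; here $x_i=x_i^{(0)}$. $[u_1,\ldots,u_n]$ is the ideal generated by all $\partial^j(u_i)$, $1\le i\le n$, $j\ge 0$. Order: $\operatorname{ord}^{\partial}_{x_j}(u)=\max\big(\{0\}\cup\{r\in\mathbb{Z}_{\ge 0}:\ \partial u/\partial x_j^{(r)}\ne 0\}\big)$ (so it is $0$ if no derivative of $x_j$ appears in $u$). Jacobi number: $J(u_1,\ldots,u_n)=\max_{\sigma\in S_n}\sum_{i=1}^n \operatorname{ord}^{\partial}_{x_i}(u_{\sigma(i)})$. Write $A=K\{x_1,\ldots,x_n\}/I$. An irreducible component $\Sigma_1$ of $\Sigma=\operatorname{Spec} A$ corresponds to a minimal prime $P$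 of $A$ (its generic point); as a scheme it is $\operatorname{Spec}(A/Q)$ with $Q=\ker(A\to A_P)$ the $P$-primary component. $\Sigma_1$ is generically reduced if the local ring $A_P$ of $\Sigma$ at the generic point is reduced (equivalently, is a field). The dimension $\dim(\Sigma_1)$ is $\operatorname{trdeg}_K\kappa(P)$, where $\kappa(P)=\operatorname{Frac}(A/P)$. *)

(* Defs.v *)
From HB Require Import structures.
From mathcomp Require Import all_boot all_algebra perm.
From mathcomp Require Import finmap boolp monalg ring.

Set Implicit Arguments.
Unset Strict Implicit.
Unset Printing Implicit Defensive.

Import GRing.Theory.

Local Open Scope ring_scope.
Local Open Scope quotient_scope.

(* [ring_quotient.idealr] only covers proper ideals of nonzero rings; here the
   unit ideal is an ideal too, because nothing prevents a differential ideal
   from being improper. *)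
Record ideal (R : comPzRingType) := Ideal {
  ideal_mem :> {pred R};
  ideal0 : 0 \in ideal_mem;
  idealD : {in ideal_mem &, forall x y, x + y \in ideal_mem};
  idealM : forall a, {in ideal_mem, forall x, a * x \in ideal_mem}
}.

Lemma ideal_zmod_closed (R : comPzRingType) (I : ideal R) :
  zmod_closed (ideal_mem I).
Proof.
split=> [|x y Ix Iy]; first exact: ideal0.
by rewrite -mulN1r; apply: idealD => //; apply: idealM.
Qed.

HB.instance Definition _ (R : comPzRingType) (I : ideal R) :=
  GRing.isZmodClosed.Build R (ideal_mem I) (ideal_zmod_closed I).

Record prime_ideal (R : comPzRingType) := PrimeIdeal {
  prime_val :> ideal R;
  prime_ideal1 : 1 \notin prime_val;
  prime_idealM :
    forall a b, a * b \in prime_val -> a \in prime_val \/ b \in prime_val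
}.

Definition minimal_prime (R : comPzRingType) (P : prime_ideal R) : Prop :=
  forall Q : prime_ideal R, {subset Q <= P} -> {subset P <= Q}.

Definition reduced (R : pzRingType) : Prop :=
  forall (x : R) (k : nat), x ^+ k = 0 -> x = 0.

Definition in_span (R : comPzRingType) (T : Type) (g : T -> R) (x : R) : Prop :=
  exists s : seq (R * T), x = \sum_(p <- s) p.1 * g p.2.

Section SpanIdeal.
Variables (R : comPzRingType) (T : Type) (g : T -> R).

Let mem : {pred R} := fun x => `[< in_span g x >].

Fact span_ideal0 : 0 \in mem.
Proof. by apply/asboolP; exists [::]; rewrite big_nil. Qed.

Fact span_idealD : {in mem &, forall x y, x + y \in mem}.
Proof.
move=> x y /asboolP[s ->] /asboolP[t ->]; apply/asboolP.
by exists (s ++ t); rewrite big_cat.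
Qed.

Fact span_idealM a : {in mem, forall x, a * x \in mem}.
Proof.
move=> x /asboolP[s ->]; apply/asboolP.
exists [seq (a * p.1, p.2) | p <- s]; rewrite big_map mulr_sumr.
by apply: eq_bigr => p _; rewrite mulrA.
Qed.

Definition span_ideal : ideal R := Ideal span_ideal0 span_idealD span_idealM.
End SpanIdeal.

Definition idquot (R : comPzRingType) (I : ideal R) : Type :=
  Quotient.quot (ideal_mem I).

Section IdealQuotient.
Variables (R : comPzRingType) (I : ideal R).
Local Notation Q := (idquot I).

HB.instance Definition _ := GRing.Zmodule.on Q.
HB.instance Definition _ : EqQuotient R (Quotient.equiv (ideal_mem I)) Q :=
  EqQuotient.on Q.

Definition idpi (x : R) : Q := \pi_Q x.

Lemma idpi_eq x y : idpi x = idpi y <-> x - y \in I.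
Proof.
rewrite (_ : (x - y \in I) = (idpi x == idpi y)); first by split=> /eqP.
exact: Quotient.idealrBE.
Qed.

Lemma idpi_repr (q : Q) : idpi (repr q) = q.
Proof. exact: reprK. Qed.

Fact idpi_is_zmod_morphism : zmod_morphism idpi.
Proof. by move=> x y; rewrite /idpi !piE. Qed.

Definition idquot_one : Q := idpi 1.
Definition idquot_mul (p q : Q) : Q := idpi (repr p * repr q).

Fact idpi_mul x y : idpi (x * y) = idquot_mul (idpi x) (idpi y).
Proof.
apply/idpi_eq; set x' := repr _; set y' := repr _.
have Ix : x - x' \in I by apply/idpi_eq; rewrite idpi_repr.
have Iy : y - y' \in I by apply/idpi_eq; rewrite idpi_repr.
have -> : x * y - x' * y' = y * (x - x') + x' * (y - y').
  by rewrite !mulrBr addrA [y * x' ]mulrC subrK mulrC.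
by apply: idealD; apply: idealM.
Qed.

Fact idquot_mulA : associative idquot_mul.
Proof.
by move=> p q r; rewrite -[p]idpi_repr -[q]idpi_repr -[r]idpi_repr
  -!idpi_mul mulrA.
Qed.

Fact idquot_mulC : commutative idquot_mul.
Proof. by move=> p q; rewrite /idquot_mul mulrC. Qed.

Fact idquot_mul1 : left_id idquot_one idquot_mul.
Proof. by move=> p; rewrite -[p]idpi_repr -idpi_mul mul1r. Qed.

Fact idquot_mulDl : left_distributive idquot_mul +%R.
Proof.
have idpiD x y : idpi x + idpi y = idpi (x + y) by rewrite /idpi !piE.
move=> p q r; rewrite -[p]idpi_repr -[q]idpi_repr -[r]idpi_repr.
by rewrite -!idpi_mul !idpiD -idpi_mul mulrDl.
Qed.

HB.instance Definition _ := GRing.Zmodule_isComPzRing.Build Q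
  idquot_mulA idquot_mulC idquot_mul1 idquot_mulDl.

HB.instance Definition _ := GRing.isZmodMorphism.Build R Q idpi
  idpi_is_zmod_morphism.

Fact idpi_is_monoid_morphism : monoid_morphism idpi.
Proof. by split=> // x y; rewrite idpi_mul. Qed.

HB.instance Definition _ := GRing.isMonoidMorphism.Build R Q idpi
  idpi_is_monoid_morphism.
End IdealQuotient.

(* The integral domain R / P; a copy of [idquot P] on which the instances that
   depend on P being prime are declared. *)
Definition domquot (R : comPzRingType) (P : prime_ideal R) : Type := idquot P.

Section PrimeQuotient.
Variables (R : comPzRingType) (P : prime_ideal R).
Local Notation D := (domquot P).

HB.instance Definition _ := GRing.ComPzRing.on D.

Definition dompi (x : R) : D := idpi P x.

HB.instance Definition _ := GRing.isZmodMorphism.Build R D dompi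
  (@idpi_is_zmod_morphism R P).
HB.instance Definition _ := GRing.isMonoidMorphism.Build R D dompi
  (@idpi_is_monoid_morphism R P).

Fact domquot_1_neq0 : 1 != 0 :> D.
Proof.
apply/eqP => D10; have /idpi_eq : idpi P 1 = idpi P 0 by rewrite raddf0.
by rewrite subr0 (negPf (prime_ideal1 P)).
Qed.

HB.instance Definition _ := GRing.PzSemiRing_isNonZero.Build D domquot_1_neq0.

Definition domquot_unit : {pred D} := fun x => `[< exists y, y * x = 1 >].
Definition domquot_inv (x : D) : D :=
  if pselect (exists y, y * x = 1) is left ex then projT1 (cid ex) else x.

Fact domquot_mulVx : {in domquot_unit, left_inverse 1 domquot_inv *%R}.
Proof.
move=> x /asboolP x_unit; rewrite /domquot_inv.
by case: pselect => // ex; case: cid.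
Qed.

Fact domquot_unitPl x y : y * x = 1 -> x \in domquot_unit.
Proof. by move=> yx1; apply/asboolP; exists y. Qed.

Fact domquot_invx_out : {in [predC domquot_unit], domquot_inv =1 id}.
Proof.
move=> x /negP; rewrite /domquot_inv; case: pselect => // ex [].
exact/asboolP.
Qed.

HB.instance Definition _ := GRing.ComNzRing_hasMulInverse.Build D
  domquot_mulVx domquot_unitPl domquot_invx_out.

Fact domquot_idomain (x y : D) : x * y = 0 -> (x == 0) || (y == 0).
Proof.
have dompi0 z : dompi z = 0 <-> z \in P.
  rewrite -{2}[z]subr0 -(idpi_eq P) raddf0; exact: iff_refl.
have -> : x = dompi (repr x) by rewrite /dompi idpi_repr.
have -> : y = dompi (repr y) by rewrite /dompi idpi_repr.
rewrite -rmorphM => /dompi0.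
by case/prime_idealM=> /dompi0 ->; rewrite eqxx ?orbT.
Qed.

HB.instance Definition _ := GRing.ComUnitRing_isIntegral.Build D
  domquot_idomain.
End PrimeQuotient.

Definition residue_field (R : comPzRingType) (P : prime_ideal R) : fieldType :=
  {fraction (domquot P)}.

Definition to_residue (R : comPzRingType) (P : prime_ideal R) :
  R -> residue_field P := fun x => tofrac (dompi P x).

HB.instance Definition _ (R : comPzRingType) (P : prime_ideal R) :=
  GRing.RMorphism.copy (to_residue P) (@tofrac (domquot P) \o dompi P).

Section Localization.
Variables (R : comPzRingType) (P : prime_ideal R).

Definition locden : Type := {s : R | s \notin P}.
HB.instance Definition _ := Choice.on locden.

Definition lval (s : locden) : R := sval s.

Fact locden1_subproof : 1 \notin P. Proof. exact: prime_ideal1. Qed.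
Definition locden1 : locden :=
  exist (fun s => is_true (s \notin P)) 1 locden1_subproof.

Fact locdenM_subproof (s t : locden) : lval s * lval t \notin P.
Proof.
apply/negP => /prime_idealM[]; apply/negP; [exact: (svalP s)|exact: (svalP t)].
Qed.
Definition locdenM (s t : locden) : locden :=
  exist (fun s => is_true (s \notin P)) _ (locdenM_subproof s t).

Fact lval1 : lval locden1 = 1. Proof. by []. Qed.
Fact lvalM s t : lval (locdenM s t) = lval s * lval t. Proof. by []. Qed.

(* a / s = b / t in R_P iff some r outside P satisfies r (a t - b s) = 0. *)
Definition loc_equiv (x y : R * locden) : bool :=
  `[< exists r : locden, lval r * (x.1 * lval y.2 - y.1 * lval x.2) = 0 >].

Fact loc_equiv_refl : reflexive loc_equiv.
Proof. by move=> x; apply/asboolP; exists locden1; rewrite subrr mulr0. Qed.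

Fact loc_equiv_sym : symmetric loc_equiv.
Proof.
move=> x y; apply/asboolP/asboolP => -[r rE]; exists r;
  by rewrite -opprB mulrN rE oppr0.
Qed.

Fact loc_equiv_trans : transitive loc_equiv.
Proof.
move=> y x z /asboolP[r rE] /asboolP[s sE]; apply/asboolP.
exists (locdenM (locdenM r s) y.2); rewrite !lvalM.
have -> : lval r * lval s * lval y.2 * (x.1 * lval z.2 - z.1 * lval x.2) =
  (lval r * (x.1 * lval y.2 - y.1 * lval x.2)) * (lval s * lval z.2) +
  (lval s * (y.1 * lval z.2 - z.1 * lval y.2)) * (lval r * lval x.2) by ring.
by rewrite rE sE !mul0r addr0.
Qed.

Canonical loc_equivRel :=
  EquivRel loc_equiv loc_equiv_refl loc_equiv_sym loc_equiv_trans.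

Definition localization : Type := {eq_quot loc_equivRel}.
Local Notation L := localization.

HB.instance Definition _ := Choice.on L.
HB.instance Definition _ := EqQuotient.on L.

Definition locfrac (a : R) (s : locden) : L := \pi_L (a, s).

Lemma locfrac_eq a s b t : locfrac a s = locfrac b t <->
  exists r : locden, lval r * (a * lval t - b * lval s) = 0.
Proof.
rewrite /locfrac; split=> [/eqmodP /asboolP //|ex].
by apply/eqmodP/asboolP.
Qed.

Let num (x : L) : R := (repr x).1.
Let den (x : L) : locden := (repr x).2.

Fact locfrac_repr (x : L) : locfrac (num x) (den x) = x.
Proof. by rewrite /locfrac -surjective_pairing reprK. Qed.

Definition loc_zero : L := locfrac 0 locden1.
Definition loc_one : L := locfrac 1 locden1.
Definition loc_opp (x : L) : L := locfrac (- num x) (den x).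
Definition loc_add (x y : L) : L :=
  locfrac (num x * lval (den y) + num y * lval (den x)) (locdenM (den x) (den y)).
Definition loc_mul (x y : L) : L :=
  locfrac (num x * num y) (locdenM (den x) (den y)).

Fact locfrac_ind (T : L -> Prop) :
  (forall a s, T (locfrac a s)) -> forall x, T x.
Proof. by move=> Tf x; rewrite -[x]locfrac_repr. Qed.

Fact loc_oppE a s : loc_opp (locfrac a s) = locfrac (- a) s.
Proof.
rewrite /loc_opp; set x := locfrac a s.
have /locfrac_eq[r rE] := locfrac_repr x.
apply/locfrac_eq; exists r.
transitivity (- (lval r * (num x * lval s - a * lval (den x)))); first by ring.
by rewrite rE oppr0.
Qed.

Fact loc_addE a s b t : loc_add (locfrac a s) (locfrac b t) =
  locfrac (a * lval t + b * lval s) (locdenM s t).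
Proof.
rewrite /loc_add; set x := locfrac a s; set y := locfrac b t.
have /locfrac_eq[r rE] := locfrac_repr x.
have /locfrac_eq[q qE] := locfrac_repr y.
apply/locfrac_eq; exists (locdenM r q); rewrite !lvalM.
transitivity
  ((lval r * (num x * lval s - a * lval (den x))) *
     (lval q * lval t * lval (den y)) +
   (lval q * (num y * lval t - b * lval (den y))) *
     (lval r * lval s * lval (den x))); first by ring.
by rewrite rE qE !mul0r addr0.
Qed.

Fact loc_mulE a s b t : loc_mul (locfrac a s) (locfrac b t) =
  locfrac (a * b) (locdenM s t).
Proof.
rewrite /loc_mul; set x := locfrac a s; set y := locfrac b t.
have /locfrac_eq[r rE] := locfrac_repr x.
have /locfrac_eq[q qE] := locfrac_repr y.
apply/locfrac_eq; exists (locdenM r q); rewrite !lvalM.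
transitivity
  ((lval r * (num x * lval s - a * lval (den x))) * (lval q * num y * lval t) +
   (lval q * (num y * lval t - b * lval (den y))) * (lval r * a * lval (den x)));
  first by ring.
by rewrite rE qE !mul0r addr0.
Qed.

Let locE := (loc_oppE, loc_addE, loc_mulE).

Local Tactic Notation "loc_ring" :=
  rewrite ?locE; apply/locfrac_eq; exists locden1; rewrite ?lvalM ?lval1; ring.

Fact loc_addA : associative loc_add.
Proof.
elim/locfrac_ind=> a s; elim/locfrac_ind=> b t; elim/locfrac_ind=> c u.
loc_ring.
Qed.

Fact loc_addC : commutative loc_add.
Proof. elim/locfrac_ind=> a s; elim/locfrac_ind=> b t; loc_ring. Qed.

Fact loc_add0 : left_id loc_zero loc_add.
Proof. elim/locfrac_ind=> a s; rewrite /loc_zero; loc_ring. Qed.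

Fact loc_addN : left_inverse loc_zero loc_opp loc_add.
Proof. elim/locfrac_ind=> a s; rewrite /loc_zero; loc_ring. Qed.

HB.instance Definition _ :=
  GRing.isZmodule.Build L loc_addA loc_addC loc_add0 loc_addN.

Fact loc_mulA : associative loc_mul.
Proof.
elim/locfrac_ind=> a s; elim/locfrac_ind=> b t; elim/locfrac_ind=> c u.
loc_ring.
Qed.

Fact loc_mulC : commutative loc_mul.
Proof. elim/locfrac_ind=> a s; elim/locfrac_ind=> b t; loc_ring. Qed.

Fact loc_mul1 : left_id loc_one loc_mul.
Proof. elim/locfrac_ind=> a s; rewrite /loc_one; loc_ring. Qed.

Fact loc_mulDl : left_distributive loc_mul loc_add.
Proof.
elim/locfrac_ind=> a s; elim/locfrac_ind=> b t; elim/locfrac_ind=> c u.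
loc_ring.
Qed.

HB.instance Definition _ := GRing.Zmodule_isComPzRing.Build L
  loc_mulA loc_mulC loc_mul1 loc_mulDl.
End Localization.

Definition derivation (R : pzRingType) (D : R -> R) : Prop :=
  {morph D : x y / x + y} /\ (forall x y, D (x * y) = D x * y + x * D y).

Fact derivation0 (R : pzRingType) (D : R -> R) : derivation D -> D 0 = 0.
Proof. by move=> [DD _]; apply: (@addrI _ (D 0)); rewrite -DD !addr0. Qed.

Fact derivation1 (R : pzRingType) (D : R -> R) : derivation D -> D 1 = 0.
Proof.
move=> [_ DM]; apply: (@addrI _ (D 1)).
by rewrite addr0 -{3}[1]mulr1 DM mulr1 mul1r.
Qed.

Fact derivation_sum (R : pzRingType) (D : R -> R) (T : Type) (F : T -> R) s t :
  {morph D : x y / x + y} -> D 0 = 0 ->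
  (forall p q, D (F p * F q) = D (F p) * F q + F p * D (F q)) ->
  D ((\sum_(p <- s) F p) * (\sum_(q <- t) F q)) =
  D (\sum_(p <- s) F p) * (\sum_(q <- t) F q) +
  (\sum_(p <- s) F p) * D (\sum_(q <- t) F q).
Proof.
move=> DD D0 DF; elim: s => [|p s IHs].
  by rewrite big_nil D0 !mul0r D0 addr0.
rewrite big_cons mulrDl !DD IHs !mulrDl [RHS]addrACA; congr (_ + _).
elim: t {IHs} => [|q t IHt]; first by rewrite big_nil D0 !mulr0 D0 addr0.
by rewrite big_cons mulrDr !DD IHt DF !mulrDr [RHS]addrACA.
Qed.

Fact derivation_comb (R : comPzRingType) (D : R -> R) (T : Type) (s : seq T)
    (p : T -> R -> R) (c : T -> R) :
  derivation D -> (forall v, derivation (p v)) ->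
  derivation (fun x => D x + \sum_(v <- s) p v x * c v).
Proof.
move=> hD hp; split=> x y /=.
  rewrite hD.1 addrACA -big_split; congr (_ + _).
  by apply: eq_bigr => v _; rewrite (hp v).1 mulrDl.
rewrite hD.2 mulrDl mulrDr addrACA mulr_suml mulr_sumr -big_split.
congr (_ + _); apply: eq_bigr => v _ /=; rewrite (hp v).2 mulrDl mulrA.
by rewrite [_ * y * _]mulrAC.
Qed.

(* [{malg K[{cmonom V}]}] is the polynomial ring over [K] in the possibly
   infinite set of variables [V]. *)
(* Terms with [m v = 0] have coefficient [0], so the truncated exponent of
   [divcm] is harmless there. Operations on polynomials are locked because
   conversion between unfolded [malg] terms is very slow. *)
HB.lock Definition pderiv (K : comNzRingType) (V : choiceType) (v : V)
    (u : {malg K[{cmonom V}]}) : {malg K[{cmonom V}]} :=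
  \sum_(m <- msupp u) << u@_m *+ m v *g divcm m (ucm v) >>.

Arguments pderiv.body {K V} v u.

Section Polynomials.
Variables (K : comNzRingType) (V : choiceType).
Local Notation pol := {malg K[{cmonom V}]}.
Implicit Types (u w : pol) (v : V) (m k : {cmonom V}).

Definition pvar v : pol := << ucm v >>.

Definition monom_eval (S : comNzRingType) (e : V -> S) m : S :=
  \prod_(v <- finsupp m) e v ^+ m v.

Definition peval (S : comNzRingType) (f : K -> S) (e : V -> S) u : S :=
  mmap f (monom_eval e) u.

Definition pvars u : {fset V} :=
  (\bigcup_(m <- msupp u) finsupp (m : {cmonom V}))%fset.

Fact mcoeff_pderiv v u m :
  (pderiv v u)@_m = u@_(mmul m (ucm v)) *+ (m v).+1.
Proof.
have mulK : divcm (mmul m (ucm v)) (ucm v) = m.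
  by apply/eqP/cmP => i; rewrite divcmE cmM addnK.
have mv : mmul m (ucm v) v = (m v).+1 by rewrite cmM cmUU addn1.
have divE k : k v != 0%N -> divcm k (ucm v) = m -> k = mmul m (ucm v).
  move=> kv <-; apply/eqP/cmP => i; rewrite cmM divcmE cmU.
  by case: eqVneq => [<-|_]; rewrite ?subn0 ?addn0 // subnK // lt0n.
rewrite pderiv.unlock raddf_sum /=.
have [m_in|m_out] := boolP (mmul m (ucm v) \in msupp u); last first.
  rewrite (mcoeff_outdom m_out) mul0rn big_seq big1 // => k k_in.
  rewrite mcoeffU; case: eqP => [kE|_]; last by rewrite mulr0n.
  have [kv0|kv] := eqVneq (k v) 0%N; first by rewrite kv0 mulr0n mul0rn.
  by rewrite (divE _ kv kE) in k_in; rewrite k_in in m_out.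
rewrite (big_fsetD1 (mmul m (ucm v))) //. rewrite mulK. have mcU x : (<< x *g m >> : pol)@_m = x by rewrite mcoeffU eqxx. rewrite [X in _ X _ = _]mcU mv.
rewrite big_seq big1 ?[LHS]addr0 // => k; rewrite in_fsetD1 => /andP[kN _].
rewrite mcoeffU; case: eqP => [kE|_]; last by rewrite mulr0n.
have [kv0|kv] := eqVneq (k v) 0%N; first by rewrite kv0 mulr0n mul0rn.
by rewrite (divE _ kv kE) eqxx in kN.
Qed.

Fact pderiv_is_zmod_morphism v : zmod_morphism (pderiv v : pol -> pol).
Proof.
by move=> u w; apply/malgP=> m; rewrite mcoeffB !mcoeff_pderiv mcoeffB mulrnBl.
Qed.

HB.instance Definition _ v :=
  GRing.isZmodMorphism.Build pol pol (pderiv v : pol -> pol) (pderiv_is_zmod_morphism v).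

Fact pderivU v c m :
  pderiv v (<< c *g m >> : pol) = << c *+ m v *g divcm m (ucm v) >>.
Proof.
rewrite pderiv.unlock msuppU; case: (eqVneq c 0) => [->|_].
  by rewrite big_seq_fset0 mul0rn monalgU0.
by rewrite big_seq_fset1 mcoeffUU.
Qed.

Fact malgUM c1 c2 m1 m2 :
  << c1 *g m1 >> * << c2 *g m2 >> = << c1 * c2 *g mmul m1 m2 >> :> pol.
Proof. exact: fgmulUU. Qed.

Fact pderivD v u w : pderiv v (u + w) = pderiv v u + pderiv v w.
Proof. exact: (raddfD (pderiv v : pol -> pol)). Qed.

Fact pderiv0 v : pderiv v (0 : pol) = 0.
Proof. exact: (raddf0 (pderiv v : pol -> pol)). Qed.

Fact malg_sum u : exists s : seq (K * {cmonom V}),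
  u = \sum_(p <- s) << p.1 *g p.2 >>.
Proof.
by exists [seq (u@_m, m) | m <- msupp u]; rewrite big_map; exact: monalgE.
Qed.

Fact pderivMU v a b m k :
  pderiv v (<< a *g m >> * << b *g k >> : pol) =
  pderiv v (<< a *g m >> : pol) * << b *g k >> +
  << a *g m >> * pderiv v (<< b *g k >> : pol).
Proof.
transitivity (<< (a * b) *+ (m v + k v)
                *g divcm (mmul m k) (ucm v) >> : pol).
  by rewrite malgUM; etransitivity; first exact: pderivU; rewrite cmM.
transitivity (<< (a *+ m v) * b *g mmul (divcm m (ucm v)) k >> +
              << a * (b *+ k v) *g mmul m (divcm k (ucm v)) >> : pol); last first.
  congr (_ + _); rewrite -malgUM; [congr (_ * _)|congr (_ * _)];
    exact/esym/pderivU.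
rewrite mulrnDr monalgUD.
have divM (x y : {cmonom V}) : x v != 0%N ->
    divcm (mmul x y) (ucm v) = mmul (divcm x (ucm v)) y.
  move=> xv; apply/eqP/cmP => i; rewrite divcmE !cmM divcmE cmU.
  by case: (eqVneq v i) => [<-|_]; rewrite ?subn0 // addnBAC // lt0n.
have mulrU (j : nat) (c : K) (h h' : {cmonom V}) : (j != 0%N -> h = h') ->
    << c *+ j *g h >> = << c *+ j *g h' >> :> pol.
  have [->|j0] := eqVneq j 0%N; first by rewrite mulr0n !monalgU0.
  by move=> /(_ isT) ->.
rewrite (mulrnAl a) (mulrnAr a b).
have e1 := mulrU (m v) (a * b) _ _ (@divM m k).
have e2 : << a * b *+ k v *g divcm (mmul m k) (ucm v) >> =
          << a * b *+ k v *g mmul m (divcm k (ucm v)) >> :> pol.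
  apply: mulrU => kv; transitivity (mmul (divcm k (ucm v)) m).
    by rewrite -(divM k m kv); congr (divcm _ _); exact: mulmC.
  exact: mulmC.
exact: (f_equal2 +%R e1 e2).
Qed.

Fact pderiv_derivation v : derivation (pderiv v : pol -> pol).
Proof.
split=> [|u w]; first exact: pderivD.
have [s ->] := malg_sum u; have [t ->] := malg_sum w.
apply: (@derivation_sum pol (pderiv v) _
  (fun p : K * {cmonom V} => << p.1 *g p.2 >>) s t (pderivD v) (pderiv0 v)).
by move=> p q; exact: pderivMU.
Qed.

Fact pderiv_eq0 v u : v \notin pvars u -> pderiv v u = 0.
Proof.
move=> v_out; apply/malgP => m; rewrite mcoeff_pderiv mcoeff0.
have [mu|/mcoeff_outdom->] := boolP (mmul m (ucm v) \in msupp u);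
  last by rewrite mul0rn.
case/negP: v_out; apply/bigfcupP; exists (mmul m (ucm v)); first by rewrite mu.
by rewrite -cmE_neq0 cmM cmUU addn1.
Qed.
End Polynomials.

Definition alg_independent (K L : fieldType) (f : {rmorphism K -> L}) (k : nat)
    (e : 'I_k -> L) : Prop :=
  forall p : {malg K[{cmonom 'I_k}]}, peval f e p = 0 -> p = 0.

(* The transcendence degree is the largest cardinality of an algebraically
   independent family; it is infinite when no [r] satisfies [has_trdeg f r]. *)
Definition has_trdeg (K L : fieldType) (f : {rmorphism K -> L}) (r : nat) : Prop :=
  (exists e : 'I_r -> L, alg_independent f e) /\
  (forall k (e : 'I_k -> L), alg_independent f e -> (k <= r)%N).

(* The variable [(i, r)] stands for the [r]-th derivative of the [i]-th
   indeterminate. *)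
Notation diffpoly K n := {malg K[{cmonom ('I_n * nat)%type}]}.

HB.lock Definition coef_deriv (K : comNzRingType) (V : choiceType) (d : K -> K)
    (u : {malg K[{cmonom V}]}) : {malg K[{cmonom V}]} :=
  \sum_(m <- msupp u) << d u@_m *g m >>.
Arguments coef_deriv.body {K V} d u.

(* The coefficientwise derivative plus the chain rule; [dp_derivation],
   [dp_derivC] and [dp_deriv_pvar] below show that this is the derivation
   extending [d] that shifts derivatives. *)
HB.lock Definition dp_deriv (K : comNzRingType) (n : nat) (d : K -> K)
    (u : diffpoly K n) : diffpoly K n :=
  coef_deriv d u + \sum_(v <- pvars u) pderiv v u * pvar K (v.1, v.2.+1).
Arguments dp_deriv.body {K n} d u.

Section DifferentialPolynomials.
Variables (K : comNzRingType) (n : nat) (d : K -> K).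
Implicit Types (u w : diffpoly K n).

(* Only the finitely many variables in [pvars u] can have a nonzero partial
   derivative ([pderiv_eq0]), and an empty maximum is [0]. *)
Definition dp_ord (j : 'I_n) u : nat :=
  (\max_(v <- pvars u | (v.1 == j) && (pderiv v u != 0%R)) v.2)%N.

Definition jacobi_number (u : 'I_n -> diffpoly K n) : nat :=
  (\max_(s : 'S_n) \sum_(i < n) dp_ord i (u (s i)))%N.

Lemma dp_ord_ge j r u : pderiv (j, r) u != 0 -> (r <= dp_ord j u)%N.
Proof.
move=> nz; have ju : (j, r) \in pvars u.
  by apply: contraNT nz => /pderiv_eq0/eqP.
by apply: (leq_bigmax_seq _ ju); rewrite eqxx nz.
Qed.

Lemma dp_ord_attained j u :
  dp_ord j u = 0%N \/ pderiv (j, dp_ord j u) u != 0.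
Proof.
rewrite /dp_ord; elim/big_rec: _ => [|[i r] x /= /andP[/eqP-> nz] IH].
  by left.
by case: (leqP r x) => _; [exact: IH | right].
Qed.

Hypothesis hd : derivation d.

Fact mcoeff_coef_deriv (V : choiceType) (u : {malg K[{cmonom V}]}) m :
  (coef_deriv d u)@_m = d u@_m.
Proof.
have d0 := derivation0 hd.
rewrite coef_deriv.unlock raddf_sum /=.
under eq_bigr do rewrite mcoeffU.
have [mu|mu] := boolP (m \in msupp u).
  rewrite (big_fsetD1 m) // eqxx mulr1n big_seq big1 ?[LHS]addr0 // => k.
  by rewrite in_fsetD1 => /andP[/negPf-> _]; rewrite mulr0n.
rewrite (mcoeff_outdom mu) d0 big_seq big1 // => k ku.
by case: eqP => [km|]; [rewrite km (negPf mu) in ku | rewrite mulr0n].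
Qed.

Fact coef_derivation (V : choiceType) :
  derivation (coef_deriv d : {malg K[{cmonom V}]} -> _).
Proof.
have dsum (T : Type) (s : seq T) (F : T -> K) :
    d (\sum_(i <- s) F i) = \sum_(i <- s) d (F i).
  by apply: big_morph; [exact: hd.1 | exact: derivation0].
have supp (w : {malg K[{cmonom V}]}) :
    (msupp (coef_deriv d w) `<=` msupp w)%fset.
  apply/fsubsetP => k; rewrite -!mcoeff_neq0 mcoeff_coef_deriv.
  by apply: contra_neq => ->; exact: derivation0.
split=> u w; apply/malgP => m; rewrite mcoeffD !mcoeff_coef_deriv.
  by rewrite mcoeffD hd.1.
rewrite (f_equal d (mcoeffMl u w m)) dsum; apply: esym.
etransitivity; first exact: (f_equal2 +%R
  (mcoeffMlw m (supp u) (fsubset_refl (msupp w)))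
  (mcoeffMlw m (fsubset_refl (msupp u)) (supp w))).
rewrite -big_split; apply: esym.
apply: eq_bigr => k _; rewrite dsum -big_split; apply: eq_bigr => l _ /=.
rewrite !mcoeff_coef_deriv; case: eqP => _; first by rewrite !mulr1n hd.2.
by rewrite !mulr0n addr0; exact: derivation0.
Qed.

Fact dp_derivEw (E : {fset 'I_n * nat}) u : (pvars u `<=` E)%fset ->
  dp_deriv d u =
  coef_deriv d u + \sum_(v <- E) pderiv v u * pvar K (v.1, v.2.+1).
Proof.
move=> uE; rewrite dp_deriv.unlock; congr (_ + _).
apply: big_fset_incl => // v _ /pderiv_eq0 ->.
by rewrite mul0r.
Qed.

Lemma dp_derivation : derivation (dp_deriv d : diffpoly K n -> _).
Proof.
have comb (E : {fset 'I_n * nat}) := derivation_comb E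
  (fun v : 'I_n * nat => pvar K (v.1, v.2.+1))
  (@coef_derivation ('I_n * nat)%type)
  (@pderiv_derivation K ('I_n * nat)%type).
split=> u w; [set x := u + w | set x := u * w];
  pose E := (pvars u `|` pvars w `|` pvars x)%fset.
all: have xE : (pvars x `<=` E)%fset by exact: fsubsetUr.
all: have uE : (pvars u `<=` E)%fset
  by rewrite /E -fsetUA; exact: fsubsetUl.
all: have wE : (pvars w `<=` E)%fset
  by rewrite /E -fsetUA fsetUCA; exact: fsubsetUl.
all: rewrite (dp_derivEw xE) (dp_derivEw uE) (dp_derivEw wE).
  exact: (comb E).1.
exact: (comb E).2.
Qed.

Lemma dp_derivC c : dp_deriv d c%:MP = (d c)%:MP :> diffpoly K n.
Proof.
have /dp_derivEw -> : (pvars (c%:MP : diffpoly K n) `<=` fset0)%fset.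
  apply/fsubsetP => v /bigfcupP[m]; rewrite andbT => /(fsubsetP (msuppC_le c)).
  by rewrite in_fset1 => /eqP ->; rewrite mdom1.
rewrite big_seq_fset0 addr0; apply/malgP => m.
rewrite mcoeff_coef_deriv (f_equal d (mcoeffC c m)); apply: esym.
etransitivity; first exact: mcoeffC.
by case: eqP => _; rewrite ?mulr1n // !mulr0n derivation0.
Qed.

Lemma dp_deriv_pvar i r :
  dp_deriv d (pvar K (i, r)) = pvar K (i, r.+1) :> diffpoly K n.
Proof.
have /dp_derivEw -> : (pvars (pvar K (i, r)) `<=` [fset (i, r)])%fset.
  by rewrite /pvars msuppU1 big_seq_fset1 mdomU.
have -> : coef_deriv d (pvar K (i, r)) = 0.
  apply/malgP => m; rewrite mcoeff_coef_deriv mcoeff0 mcoeffU1.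
  by case: eqP => _; [exact: derivation1 | exact: derivation0].
rewrite big_seq_fset1 add0r; set v := (i, r).
suff -> : pderiv v (pvar K v) = 1 by rewrite mul1r.
etransitivity; first exact: pderivU.
rewrite (cmUU v) mulr1n.
suff e : divcm (ucm v) (ucm v) = mone by exact: (f_equal (mkmalgU^~ 1) e).
by apply/eqP/cmP => k; rewrite divcmE subnn cm1.
Qed.
End DifferentialPolynomials.

Section Components.
Variables (K : fieldType) (d : K -> K) (n : nat) (u : 'I_n -> diffpoly K n).

Definition diff_ideal : ideal (diffpoly K n) :=
  span_ideal (fun p : 'I_n * nat => iter p.2 (dp_deriv d) (u p.1)).

Definition sigma_ring : comPzRingType := idquot diff_ideal.

Definition scalar_to_residue (P : prime_ideal sigma_ring) (c : K) :
    residue_field P :=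
  to_residue P (idpi diff_ideal c%:MP).

HB.instance Definition _ (P : prime_ideal sigma_ring) :=
  GRing.RMorphism.copy (scalar_to_residue P)
    (to_residue P \o idpi diff_ideal \o @malgC _ K).

(* The irreducible components of the spectrum are represented by the minimal
   primes [P] of [sigma_ring]; the dimension is the transcendence degree of the
   residue field of [P] over [K]. *)
Definition component_dim (P : prime_ideal sigma_ring) (r : nat) : Prop :=
  has_trdeg (scalar_to_residue P) r.
End Components.

(* Main.v *)
Require Import Defs.
From HB Require Import structures.
From mathcomp Require Import all_boot all_order all_algebra perm.
From mathcomp Require Import finmap boolp classical_sets functions monalg.
From mathcomp Require Import zify ring.

Set Implicit Arguments.
Unset Strict Implicit.
Unset Printing Implicit Defensive.

Import GRing.Theory.

Local Open Scope ring_scope.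

(** Let [phi] be evaluation at the generic point of the component, with values
    in the residue field [L]. Generic reducedness says that a differential
    polynomial [p] killed by [phi] satisfies [s * p \in I] for some [s] with
    [phi s != 0] ([generic_annihilator]). Hence the kernel of [phi] is stable
    under the derivation, which therefore descends to [L]
    ([fraction_derivation]), and the covectors [phi (dp / dx_i^(s))] of the
    elements [p] of the kernel are combinations of those of the derivatives of
    the [u_k]: linearizing the system at the generic point loses nothing.
    Derivation of [p] becomes on covectors the semilinear operator [nabla], so
    the linearization is an [n x n] linear differential system over [L].

    Counting solutions against equations. A transcendence basis [e_1 .. e_r]
    of [L] over [K] gives, in characteristic zero, derivations of [L] dual to it
    ([transcendence_derivation]). By the chain rule their values on the
    coordinates solve every linearized equation, and restricted to enough
    coordinates they stay linearly independent. So, if [F] is a large finite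
    set of coordinates and [R] a set of linearly independent derived equations
    involving only coordinates of [F], then [r + #|R| <= #|F|]
    ([orthogonal_card]).

    The derived equations are independent ([equations_independent]). As the
    transcendence degree is finite, for each [i] the elements [x_i^(s)] with
    [s <= r] are algebraically dependent on the component, and differentiating
    a relation of minimal degree gives a nonzero covector in the span of the
    equations, supported on the coordinates of [x_i] alone. Its prolongations force the
    span of the first [M] derivatives of the equations to have dimension at
    least [n * M - c], whereas a single linear dependence among the derived
    equations would bound it by [(n - 1) * M + c] ([rows_independent]).

    Choice of [F] and [R]. Duality for the assignment problem ([egervary]) gives
    [lam] and [mu] with [ord_i u_k + lam k <= mu i] and
    [\sum mu <= \sum lam + J]. The derivatives of [u_k] of order less than
    [M + lam k] involve only the [x_i^(s)] with [s < M + mu i], and the count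
    reads [r + \sum (M + lam k) <= \sum (M + mu i)], that is [r <= J]. *)

(** * Optimal assignments and dual potentials *)

Section Assignment.
Import Order.TTheory Num.Theory.
Variable n : nat.
Implicit Types (v : 'I_n -> 'I_n -> int) (x y : 'I_n) (p q : seq 'I_n).

Fixpoint path_weight v x p : int :=
  if p is y :: q then v x y + path_weight v y q else 0.

Lemma path_weight_cat v x p y q :
  path_weight v x (p ++ y :: q) =
  path_weight v x (rcons p y) + path_weight v y q.
Proof. by elim: p x => [|z p IHp] x /=; rewrite ?addr0 // IHp addrA. Qed.

(** For [y0 = y] the walk is a cycle, and the left-hand side expresses its
    weight through the permutation sending each entry to its cyclic successor. *)
Lemma cycle_weight v y0 y p : uniq (y :: p) ->
  \sum_(x <- y :: p) v x (next_at x y0 y p) = path_weight v y (rcons p y0).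
Proof.
elim: p y => [|z p IHp] y /= => [_|/andP[yp Up]].
  by rewrite big_seq1 eqxx addr0.
rewrite big_cons eqxx -(IHp z Up); congr (_ + _).
rewrite !big_seq; apply: eq_bigr => x xp.
by case: eqP xp => [->|//]; rewrite (negPf yp).
Qed.

Lemma next_at_out x y0 y p : x \notin y :: p -> next_at x y0 y p = x.
Proof.
elim: p y => [|z p IHp] y /=; first by rewrite mem_seq1 => /negPf->.
by rewrite in_cons negb_or => /andP[/negPf-> xp]; apply: IHp.
Qed.

Lemma cycle_weight_le0 v x p :
    (forall y, v y y = 0) -> (forall s : 'S_n, \sum_y v y (s y) <= 0) ->
    uniq (x :: p) ->
  path_weight v x (rcons p x) <= 0.
Proof.
move=> v0 v_le0 Uc; rewrite -cycle_weight //.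
pose s := perm (can_inj (prev_next Uc)).
apply: le_trans (v_le0 s); rewrite le_eqVlt; apply/orP; left; apply/eqP.
rewrite [RHS](bigID (mem (x :: p))) /= [X in _ = _ + X]big1 ?addr0 => [|y yNp].
  by rewrite -big_uniq //=; apply: eq_bigr => y _; rewrite permE.
by rewrite permE /= next_at_out // v0.
Qed.

(** A path without repetition has fewer than [n] steps, so there are finitely
    many of them and one has maximal weight. *)
Lemma longest_path v x : exists2 p, uniq (x :: p) &
  forall q, uniq (x :: q) -> path_weight v x q <= path_weight v x p.
Proof.
pose T := {k : 'I_n & k.-tuple 'I_n}.
have x_n : (0 < n)%N by exact: leq_ltn_trans (ltn_ord x).
pose t0 : T :=
  Tagged (fun k : 'I_n => k.-tuple 'I_n) (i := Ordinal x_n) [tuple].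
pose F (t : T) := path_weight v x (tagged t).
have := @Order.TotalTheory.arg_maxP _ _ T t0
  (fun t : T => uniq (x :: tagged t)) F isT.
case=> t Ut tmax; exists (tagged t) => // q Uq.
have q_n : (size q < n)%N.
  by rewrite -[n in (_ < n)%N]card_ord -[(_ < _)%N]/(size (x :: q) <= _)%N
    -(card_uniqP Uq) max_card.
pose tq : T := Tagged (fun k : 'I_n => k.-tuple 'I_n) (i := Ordinal q_n)
  (in_tuple q).
exact: (tmax tq).
Qed.

(** When no permutation has positive weight, no cycle has; the maximal weight of
    a simple path starting at [x] is then a potential, since a step that closes
    a loop can be cut out without loss. *)
Lemma potential v :
    (forall y, v y y = 0) -> (forall s : 'S_n, \sum_y v y (s y) <= 0) ->
  exists2 h : 'I_n -> int, (forall x, 0 <= h x)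
    & forall x y, v x y + h y <= h x.
Proof.
move=> v0 v_le0.
pose h x := path_weight v x (s2val (cid2 (longest_path v x))).
have h_max x q : uniq (x :: q) -> path_weight v x q <= h x.
  by move=> Uq; rewrite /h; case: cid2 => p /= Up; apply.
exists h => [x|x y]; first exact: (h_max x [::]).
rewrite [h y]/h; case: cid2 => p Up _ /=.
rewrite -[_ + _]/(path_weight v x (y :: p)).
have [xp|xNp] := boolP (x \in y :: p); last first.
  by apply: h_max; rewrite cons_uniq xNp.
case/splitPr: xp Up => p1 p2; rewrite path_weight_cat cat_uniq => /and3P[U1].
move=> /hasPn/(_ x (mem_head _ _)) x1 U2.
rewrite -[h x]add0r lerD ?h_max //.
by apply: cycle_weight_le0 => //=; rewrite U1 andbT.
Qed.

(** Fix an optimal permutation [s0] and weigh the arc from [x] to [y] by what is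
    gained at [x] when the row [s0 x] is replaced by the row [s0 y]. Optimality
    of [s0] says that no permutation has positive weight; a potential of these
    weights, transported along [s0], is [lam], and [mu] is then forced by
    equality on the entries chosen by [s0]. *)
Theorem egervary (a : 'I_n -> 'I_n -> nat) :
  exists lam mu : 'I_n -> nat, (forall k i, a k i + lam k <= mu i)%N /\
    (\sum_i mu i <=
       \sum_i lam i + \max_(s : 'S_n) \sum_i a (s i) i)%N.
Proof.
pose wt (s : 'S_n) := (\sum_i a (s i) i)%N.
have /bigop.eq_bigmax-/(_ wt)[s0 s0E] : (0 < #|{: 'S_n}|)%N.
  by apply/card_gt0P; exists 1%g.
have s0_max s : (wt s <= wt s0)%N by rewrite -s0E leq_bigmax.
pose v x y : int := (a (s0 y) x)%:Z - (a (s0 x) x)%:Z.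
have [|s|h h0 hv] := @potential v; first by move=> y; rewrite /v subrr.
  rewrite /v sumrB subr_le0 -!(big_morph Posz PoszD (erefl 0%:Z)) lez_nat.
  apply: leq_trans (s0_max (s * s0)%g); apply/eq_leq/eq_bigr => i _.
  by rewrite permM.
have hE x : h x = `|h x|%N :> int by rewrite gez0_abs.
exists (fun k => `|h ((s0^-1)%g k)|%N), (fun i => `|h i| + a (s0 i) i)%N.
split=> [k i|].
  have := hv i ((s0^-1)%g k); rewrite /v permKV hE [h i]hE; lia.
rewrite big_split /= leq_add //; last by rewrite -/(wt s0) -s0E.
rewrite [leqRHS](reindex_perm s0); apply/eq_leq/eq_bigr => i _.
by rewrite permK.
Qed.
End Assignment.

(** * Spans and linear independence *)

Section Spans.
Variables (L : fieldType) (U : lmodType L).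
Implicit Types (M S : U -> Prop).

Definition submodule M : Prop :=
  M 0 /\ forall a x y, M x -> M y -> M (a *: x + y).

(** Spans of arbitrary sets of vectors of a possibly infinite-dimensional space,
    as intersections of submodules: membership is used by choosing the
    submodule. *)
Definition lspan S x : Prop :=
  forall M, submodule M -> (forall s, S s -> M s) -> M x.

Lemma lspan_submodule S : submodule (lspan S).
Proof.
split=> [M [] //|a x y Sx Sy M hM SM].
by apply: hM.2; [apply: Sx | apply: Sy].
Qed.

Lemma mem_lspan S x : S x -> lspan S x.
Proof. by move=> Sx M _; apply. Qed.

Lemma lspan0 S : lspan S 0. Proof. exact: (lspan_submodule S).1. Qed.

Lemma lspanZ S a x : lspan S x -> lspan S (a *: x).
Proof.
move=> Sx; rewrite -[_ *: _]addr0; apply: (lspan_submodule S).2 => //.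
exact: lspan0.
Qed.

Lemma lspanD S x y : lspan S x -> lspan S y -> lspan S (x + y).
Proof. by move=> Sx Sy; rewrite -[x]scale1r; apply: (lspan_submodule S).2. Qed.

Lemma lspan_sum S (I : Type) (r : seq I) (P : pred I) (F : I -> U) :
  (forall i, P i -> lspan S (F i)) -> lspan S (\sum_(i <- r | P i) F i).
Proof. by move=> SF; apply: big_ind => //; [exact: lspan0 | exact: lspanD]. Qed.

Lemma lspan_sub S S' x :
  (forall s, S s -> lspan S' s) -> lspan S x -> lspan S' x.
Proof. by move=> SS'; apply=> //; exact: lspan_submodule. Qed.

Lemma lspan_finite (Y : finType) (g : Y -> U) x :
  lspan (fun s => exists j, s = g j) x ->
  exists c : Y -> L, x = \sum_j c j *: g j.
Proof.
move=> /(_ (fun x => exists c : Y -> L, x = \sum_j c j *: g j)).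
apply=> [|_ [y ->]]; last first.
  exists (fun z => (z == y)%:R); rewrite (bigD1 y) //= eqxx scale1r.
  by rewrite big1 ?addr0 // => z /negPf->; rewrite scale0r.
split=> [|a _ _ [c ->] [d ->]].
  by exists (fun=> 0); rewrite big1 // => y _; rewrite scale0r.
exists (fun y => a * c y + d y); rewrite scaler_sumr -big_split.
by apply: eq_bigr => y _; rewrite scalerDl scalerA.
Qed.

Definition lfree (X : finType) (t : X -> U) : Prop :=
  forall z : X -> L, \sum_x z x *: t x = 0 -> forall x, z x = 0.

(** The matrix expressing a free family in terms of a generating one has no left
    kernel, hence at least as many columns as rows. *)
Lemma lfree_card_le (X Y : finType) (t : X -> U) (g : Y -> U) :
    lfree t -> (forall x, lspan (fun s => exists j, s = g j) (t x)) ->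
  (#|X| <= #|Y|)%N.
Proof.
move=> t_free t_span; have [c tE] := choice (fun x => lspan_finite (t_span x)).
pose C := \matrix_(i < #|X|, j < #|Y|) c (enum_val i) (enum_val j).
suff : row_free C by move=> /eqP <-; exact: rank_leq_col.
rewrite -kermx_eq0; apply/rowV0P => z.
move=> /sub_kermxP zC; apply/rowP => i; rewrite mxE.
rewrite -[i]enum_valK; set x := enum_val i.
pose Z x := z 0 (enum_rank x); rewrite -/(Z x); apply: t_free => {x}.
under eq_bigr do rewrite tE scaler_sumr.
rewrite exchange_big big1 // => y _ /=.
under eq_bigr do rewrite scalerA.
have /rowP/(_ (enum_rank y)) := zC; rewrite !mxE => zCy.
rewrite -scaler_suml (_ : \sum_x _ = 0) ?scale0r // -[RHS]zCy.
rewrite [RHS](reindex enum_rank); last exact/onW_bij/enum_rank_bij.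
by apply: eq_bigr => x _; rewrite mxE !enum_rankK.
Qed.
End Spans.

(** The ranks of two matrices with zero product add up to at most the common
    dimension. *)
Lemma orthogonal_card (L : fieldType) (X Y Z : finType)
    (w : X -> Z -> L) (g : Y -> Z -> L) :
    (forall c : X -> L,
      (forall z, \sum_x c x * w x z = 0) -> forall x, c x = 0) ->
    (forall c : Y -> L,
      (forall z, \sum_y c y * g y z = 0) -> forall y, c y = 0) ->
    (forall x y, \sum_z w x z * g y z = 0) ->
  (#|X| + #|Y| <= #|Z|)%N.
Proof.
move=> w_free g_free wg0.
have free (T : finType) (h : T -> Z -> L) :
    (forall c : T -> L,
      (forall z, \sum_x c x * h x z = 0) -> forall x, c x = 0) ->
    \rank (\matrix_(i < #|T|, j < #|Z|) h (enum_val i) (enum_val j)) = #|T|.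
  move=> h_free; apply/eqP; rewrite -/(row_free _) -kermx_eq0.
  apply/rowV0P => c /sub_kermxP cH; apply/rowP => i; rewrite mxE.
  rewrite -[i]enum_valK; apply: (h_free (fun x => c 0 (enum_rank x))) => z.
  have /rowP/(_ (enum_rank z)) := cH; rewrite !mxE => cHz; rewrite -[RHS]cHz.
  rewrite [RHS](reindex enum_rank); last exact/onW_bij/enum_rank_bij.
  by apply: eq_bigr => x _; rewrite mxE !enum_rankK.
rewrite -(free _ _ w_free) -(free _ _ g_free) -[X in (_ + X)%N]mxrank_tr.
apply: mulmx0_rank_max; apply/matrixP => i j; rewrite !mxE.
rewrite -[RHS](wg0 (enum_val i) (enum_val j)).
rewrite [RHS](reindex (@enum_val _ Z)); last exact/onW_bij/(enum_val_bij Z).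
by apply: eq_bigr => x _; rewrite !mxE.
Qed.

(** * Growth of prolonged linear systems *)

Section Growth.
Variables (L : fieldType) (U : lmodType L) (D : L -> L) (nabla : U -> U).
Hypothesis nablaD : {morph nabla : x y / x + y}.
Hypothesis nablaZ : forall a x, nabla (a *: x) = D a *: x + a *: nabla x.

Lemma nabla_lspan (S S' : U -> Prop) x :
    (forall s, S s -> lspan S' s /\ lspan S' (nabla s)) ->
  lspan S x -> lspan S' (nabla x).
Proof.
move=> SS' /(_ (fun x => lspan S' x /\ lspan S' (nabla x))) Sx.
apply: (Sx _ _).2 => //; split=> [|a u v [u1 u2] [v1 v2]].
  have nabla0 : nabla 0 = 0.
    by apply: (@addrI _ (nabla 0)); rewrite -nablaD !addr0.
  by rewrite nabla0; split; exact: lspan0.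
split; first by apply: lspanD; [exact: lspanZ|].
rewrite nablaD nablaZ; apply: lspanD => //; apply: lspanD; exact: lspanZ.
Qed.

Variables (n : nat) (rho tau : 'I_n -> U) (c : nat).
Hypothesis tau_free : forall T : nat,
  lfree (fun p : 'I_n * 'I_T => iter p.2 nabla (tau p.1)).
Hypothesis tau_span : forall i,
  lspan (fun s => exists k j, (j < c)%N /\ s = iter j nabla (rho k)) (tau i).

(** Comparison of two rates of growth. If the prolonged rows [rho] were
    dependent, then from some [j0] on every prolongation of one of them, of
    index [k0], would lie in the span of the other rows and of the first [j0]
    prolongations of row [k0]: that span [Sp t] grows by [n - 1] dimensions when
    [t] increases by one. But it contains the free prolongations of the [n]
    vectors [tau], which grow by [n]. *)
Lemma rows_independent (N : 'I_n -> nat) :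
  lfree (fun p : {k : 'I_n & 'I_(N k)} => iter (tagged p) nabla (rho (tag p))).
Proof.
move=> z z0 [k0 j1]; apply: contrapT => /eqP zp1.
pose zz j := if insub j is Some j' then
  z (Tagged (fun k => 'I_(N k)) (j' : 'I_(N k0))) else 0.
have zzE (j' : 'I_(N k0)) : zz j' = z (Tagged (fun k => 'I_(N k)) j').
  by rewrite /zz valK.
have ex_j : exists j, zz j != 0.
  by exists j1; rewrite zzE.
have zz_out j : zz j != 0 -> (j <= N k0)%N.
  by rewrite /zz; case: insubP => [j' /ltnW|]; rewrite ?eqxx.
(* The highest prolongation of row [k0] in the relation is a combination of the
   remaining ones; applying the operator repeatedly propagates this. *)
have [j0 zj0 j0_max] := ex_maxnP ex_j zz_out.
pose B := (\max_k N k)%N; pose g k j := iter j nabla (rho k).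
pose Sp t s := (exists k j, [/\ k != k0, (j < B + t)%N & s = g k j]) \/
  (exists2 j, (j < j0)%N & s = g k0 j).
have Sp_mono t t' s : (t <= t')%N -> Sp t s -> Sp t' s.
  move=> tt' [[k [j [kk jB ->]]]|]; last by right.
  by left; exists k, j; split=> //; apply: leq_trans jB _; rewrite leq_add2l.
have lead0 : lspan (Sp 0%N) (g k0 (j0 + 0)%N).
    have j0N : (j0 < N k0)%N.
      by move: zj0; rewrite /zz; case: insubP => [j' //|]; rewrite eqxx.
    pose p0 := Tagged (fun k => 'I_(N k)) (Ordinal j0N).
    have zp0 : z p0 != 0 by rewrite -[z p0]zzE.
    rewrite addn0 -[g _ _]scale1r -(mulVf zp0) -scalerA; apply: lspanZ.
    have -> : z p0 *: g k0 j0 =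
        - \sum_(p | p != p0) z p *: iter (tagged p) nabla (rho (tag p)).
      apply/eqP; rewrite -addr_eq0; apply/eqP; rewrite -[RHS]z0.
      by rewrite [RHS](bigD1 p0).
    rewrite -[- _]scaleN1r; apply: lspanZ; apply: lspan_sum => -[k j] /= pN.
    have [kk|kN] := eqVneq k k0; last first.
      apply: lspanZ; apply: mem_lspan; left; exists k, j; split=> //.
      by rewrite addn0; apply: leq_trans (leq_bigmax k).
    case: _ / (esym kk) j pN => j pN; rewrite -zzE.
    have [->|zj] := eqVneq (zz j) 0; first by rewrite scale0r; apply: lspan0.
    apply: lspanZ; apply: mem_lspan; right; exists j => //.
    rewrite ltn_neqAle j0_max // andbT; apply: contra pN => /eqP jj.
    by apply/eqP; congr existT; apply: val_inj.
have lead t : lspan (Sp t) (g k0 (j0 + t)%N).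
  elim: t => [//|t IHt].
  have span0 s : Sp t s -> lspan (Sp t.+1) s.
    by move=> Ss; apply: mem_lspan; apply: Sp_mono Ss.
  rewrite addnS; apply: nabla_lspan IHt => s Ss; split; first exact: span0.
  case: Ss => [[k [j [kk jB ->]]]|[j jj ->]].
    apply: mem_lspan; left; exists k, j.+1; split=> //.
    by rewrite addnS.
  have [jj1|jj1] := ltnP j.+1 j0; first by apply: mem_lspan; right; exists j.+1.
  suff -> : nabla (g k0 j) = g k0 (j0 + 0)%N.
    by apply: lspan_sub lead0 => s' Ss'; apply: mem_lspan; apply: Sp_mono Ss'.
  by rewrite addn0 (_ : j0 = j.+1) //; apply/eqP; rewrite eqn_leq jj jj1.
have spanT M k j : (j < M)%N -> lspan (Sp M) (g k j).
  move=> jM; have [->|kk] := eqVneq k k0; last first.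
    apply: mem_lspan; left; exists k, j; split=> //.
    exact: leq_trans (leq_addl _ _).
  have [jj|jj] := ltnP j j0; first by apply: mem_lspan; right; exists j.
  rewrite -(subnKC jj); apply: lspan_sub (lead _) => s Ss.
  apply: mem_lspan; apply: Sp_mono Ss.
  exact: leq_trans (leq_subr _ _) (ltnW _).
have tauT i t : lspan (fun s => exists k j, (j < c + t)%N /\ s = g k j)
    (iter t nabla (tau i)).
  elim: t => [|t IHt].
    by rewrite addn0; exact: tau_span.
  apply: nabla_lspan IHt => s [k [j [jt ->]]].
  split; apply: mem_lspan; [exists k, j|exists k, j.+1].
    by split=> //; apply: leq_trans jt _; rewrite addnS.
  by rewrite addnS.
(* The first value at which [n * T] exceeds [n.-1 * (B + (c + T)) + j0]. *)
pose T := (n.-1 * (B + c) + j0).+1.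
pose Y : finType := ({k : 'I_n | k != k0} * 'I_(B + (c + T)) + 'I_j0)%type.
pose gY (y : Y) : U := match y with
  | inl p => g (val p.1) p.2 | inr j => g k0 j end.
have := @lfree_card_le _ _ _ Y _ gY (@tau_free T).
rewrite card_sum !card_prod card_sig !card_ord cardC1 card_ord.
have n0 : (0 < n)%N by exact: leq_ltn_trans (ltn_ord k0).
have bound : (n * T <= n.-1 * (B + (c + T)) + j0)%N -> False.
  by rewrite -{1}(prednK n0) mulSn !mulnDr {1}/T; lia.
  move=> H; apply: bound; apply: H => -[i t] /=.
  apply: lspan_sub (tauT i t) => s [k [j [jt ->]]].
  apply: (@lspan_sub _ _ (Sp (c + T)%N)); last first.
    by apply: spanT; apply: leq_trans jt _; rewrite leq_add2l ltnW.
  move=> {}s Ss; apply: mem_lspan.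
  case: Ss => [[k' [j' [kk jB ->]]]|[j' jj ->]].
    by exists (inl (exist (fun k => k != k0) k' kk, Ordinal jB)).
  by exists (inr (Ordinal jj)).

Qed.
End Growth.

(** * Extending derivations *)

Definition derivation_on (L : fieldType) (A : {pred L}) (d : L -> L) : Prop :=
  {in A &, forall x y, d (x + y) = d x + d y} /\
  {in A &, forall x y, d (x * y) = d x * y + x * d y}.

(** The subring generated by [A] and [z]. Derivations are extended along such
    subrings, whose elements are polynomials in [z], so that no inverse has to
    be dealt with. *)
Definition adjoin (L : fieldType) (A : {pred L}) (z : L) : {pred L} :=
  fun x => `[< exists2 g : {poly L}, g \is a polyOver A & x = g.[z] >].

Section Adjoin.
Variables (L : fieldType) (A : subringClosed L) (z : L).

Fact adjoin_subring_closed : subring_closed (adjoin A z).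
Proof.
split=> [|x y /asboolP[g gA ->] /asboolP[h hA ->]|
          x y /asboolP[g gA ->] /asboolP[h hA ->]]; apply/asboolP.
- by exists 1; rewrite ?hornerC // rpred1.
- by exists (g - h); rewrite ?hornerE // rpredB.
- by exists (g * h); rewrite ?hornerE // rpredM.
Qed.

HB.instance Definition _ :=
  GRing.isSubringClosed.Build L (adjoin A z) adjoin_subring_closed.

Lemma sub_adjoin : {subset A <= adjoin A z}.
Proof.
by move=> x xA; apply/asboolP; exists x%:P; rewrite ?polyOverC ?hornerC.
Qed.

Lemma adjoin_gen : z \in adjoin A z.
Proof. by apply/asboolP; exists 'X; rewrite ?polyOverX ?hornerX. Qed.
End Adjoin.

Section DerivationOn.
Variables (L : fieldType) (A : subringClosed L) (d : L -> L).
Hypothesis hd : derivation_on A d.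
Implicit Types g h : {poly L}.

Lemma derivation_on0 : d 0 = 0.
Proof. by apply: (@addrI _ (d 0)); rewrite -hd.1 ?rpred0 // !addr0. Qed.

Lemma derivation_on1 : d 1 = 0.
Proof.
apply: (@addrI _ (d 1)); rewrite addr0 -{3}[1]mulr1 hd.2 ?rpred1 //.
by rewrite mulr1 mul1r.
Qed.

Lemma derivation_onN1 : d (-1) = 0.
Proof.
apply: (@addIr _ (d 1)); rewrite -hd.1 ?rpredN1 ?rpred1 // addNr.
by rewrite derivation_on0 derivation_on1 addr0.
Qed.

Lemma derivation_on_sum (I : Type) (r : seq I) (F : I -> L) :
  (forall i, F i \in A) -> d (\sum_(i <- r) F i) = \sum_(i <- r) d (F i).
Proof.
move=> FA; elim: r => [|i r IHr]; first by rewrite !big_nil derivation_on0.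
by rewrite !big_cons hd.1 ?IHr // rpred_sum.
Qed.

Lemma coef_map_derivation g i : (map_poly d g)`_i = d g`_i.
Proof. exact/coef_map_id0/derivation_on0. Qed.

Lemma map_derivationD : {in polyOver A &, forall g h,
  map_poly d (g + h) = map_poly d g + map_poly d h}.
Proof.
move=> g h /polyOverP gA /polyOverP hA; apply/polyP => i.
by rewrite coefD !coef_map_derivation coefD hd.1.
Qed.

Lemma map_derivationM : {in polyOver A &, forall g h,
  map_poly d (g * h) = map_poly d g * h + g * map_poly d h}.
Proof.
move=> g h /polyOverP gA /polyOverP hA; apply/polyP => i.
rewrite coefD !coef_map_derivation !coefM derivation_on_sum => [|j].
  rewrite -big_split; apply: eq_bigr => j _.
  by rewrite hd.2 // !coef_map_derivation.
by rewrite rpredM.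
Qed.

Lemma map_derivationC c : map_poly d c%:P = (d c)%:P.
Proof.
by apply/polyP => i; rewrite coef_map_derivation !coefC; case: eqP => // _;
  rewrite derivation_on0.
Qed.

(** The value at [z] is determined by this formula when [z] is a root of [g] and
    not of [g^`()]; this is why algebraic extensions of a derivation are
    unique. *)
Lemma derivation_on_horner g z : g \is a polyOver A -> z \in A ->
  d g.[z] = (map_poly d g).[z] + g^`().[z] * d z.
Proof.
move=> + zA; elim/poly_ind: g => [_|g c IHg /polyOverP gcA].
  by rewrite -polyC0 map_derivationC derivC !hornerC mul0r addr0.
have cA : c \in A by have := gcA 0%N; rewrite coefD coefMX coefC add0r.
have gA : g \is a polyOver A.
  apply/polyOverP => i; have := gcA i.+1.
  by rewrite coefD coefMX coefC addr0.
have gzA : g.[z] \in A by exact: rpred_horner.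
rewrite !hornerE hd.1 ?rpredM // hd.2 // IHg //.
rewrite map_derivationD ?rpredM ?polyOverX ?polyOverC //.
rewrite map_derivationM ?polyOverX //.
rewrite map_derivationC derivD derivM derivX derivC.
have -> : map_poly d 'X = 0.
  apply/polyP => i; rewrite coef_map_derivation coefX coef0.
  by case: eqP; rewrite ?derivation_on0 ?derivation_on1.
by rewrite !hornerE; ring.
Qed.

Variable z : L.

Definition alg_over := exists g, [/\ g \is a polyOver A, g != 0 & g.[z] = 0].

Hypothesis L_char0 : [pchar L] =i pred0.

(** A relation of minimal degree: its derivative has smaller degree and is not
    zero, since the characteristic is zero. *)
Lemma separable_relation : alg_over -> exists m, [/\ m \is a polyOver A,
  m.[z] = 0, m^`().[z] != 0 &
  {in polyOver A, forall g, g.[z] = 0 -> (size g < size m)%N -> g = 0}].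
Proof.
case=> g0 [g0A g0_neq0 g0z].
pose is_size k := `[< exists g,
  [/\ g \is a polyOver A, g != 0, g.[z] = 0 & size g = k] >].
have ex_size : exists k, is_size k.
  by exists (size g0); apply/asboolP; exists g0.
have [k /asboolP[m [mA m_neq0 mz <-]] k_min] := ex_minnP ex_size.
have min g : g \is a polyOver A -> g.[z] = 0 -> (size g < size m)%N -> g = 0.
  move=> gA gz; apply: contraTeq => g_neq0; rewrite -leqNgt k_min //.
  by apply/asboolP; exists g.
exists m; split=> //; apply/eqP => dmz; case/eqP: (m_neq0).
have dm0 : m^`() = 0.
  apply: min => //; last by rewrite lt_size_deriv.
  by apply/polyOverP => i; rewrite coef_deriv rpredMn // (polyOverP mA).
have mE : m = (m`_0)%:P.
  apply/polyP => -[|i]; rewrite coefC //=.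
  have /polyP/(_ i)/eqP := dm0; rewrite coef_deriv coef0.
  by rewrite -mulr_natr mulf_eq0 (pcharf0P L).1 // orbF => /eqP.
by move: mz; rewrite mE hornerC => ->.
Qed.

(** The extension must send [g.[z]] to [T g] below, with the value [w] at [z]
    dictated by the minimal relation [m]. That [T] kills all relations is proved
    by pseudo-division by [m], which multiplies by the leading coefficient of
    [m] instead of dividing by it. *)
Lemma adjoin_derivation : alg_over -> exists d' : L -> L,
  derivation_on (adjoin A z) d' /\ {in A, d' =1 d}.
Proof.
case/separable_relation=> m [mA mz dmz m_min].
pose w := - (map_poly d m).[z] / m^`().[z].
pose T g := (map_poly d g).[z] + g^`().[z] * w.
have TD : {in polyOver A &, forall g h, T (g + h) = T g + T h}.
  by move=> g h gA hA; rewrite /T map_derivationD // derivD !hornerD; ring.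
have TM : {in polyOver A &, forall g h, T (g * h) = T g * h.[z] + g.[z] * T h}.
  move=> g h gA hA; rewrite /T map_derivationM // derivM !(hornerD, hornerM).
  by ring.
have TC c : T c%:P = d c.
  by rewrite /T map_derivationC derivC horner0 hornerC mul0r addr0.
have T0 : T 0 = 0 by rewrite -[0]/(0%:P) TC derivation_on0.
have Tm : T m = 0 by rewrite /T /w mulrC divfK // subrr.
have T_wd g : g \is a polyOver A -> g.[z] = 0 -> T g = 0.
  have [k] := ubnP (size g); elim: k g => // k IHk g gk gA gz.
  have [gm|mg] := ltnP (size g) (size m); first by rewrite (m_min g).
  have lA h : h \is a polyOver A -> lead_coef h \in A.
    by move=> /polyOverP hA; apply: hA.
  pose q := (lead_coef g)%:P * 'X^(size g - size m).
  have qA : q \is a polyOver A.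
    by rewrite rpredM ?polyOverC ?lA // rpredX ?polyOverX.
  have m_neq0 : m != 0 by apply: contraNneq dmz => ->; rewrite deriv0 horner0.
  pose h := (lead_coef m)%:P * g + (-1)%:P * (q * m).
  have N1A : (-1)%:P \is a polyOver A by rewrite polyOverC rpredN1.
  have lmA : (lead_coef m)%:P \is a polyOver A by rewrite polyOverC lA.
  have hA : h \is a polyOver A by rewrite /h rpredD // rpredM // rpredM.
  have g_gt0 : (0 < size g)%N by apply: leq_trans mg; rewrite size_poly_gt0.
  have m_gt0 : (0 < size m)%N by rewrite size_poly_gt0.
  have hk : (size h < k)%N.
    apply: (@leq_trans (size g)) => //; rewrite -[ltnRHS](prednK g_gt0) ltnS.
    apply/leq_sizeP => j; rewrite leq_eqVlt => /orP[/eqP<-|gj];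
      rewrite coefD !coefCM -mulrA coefCM coefXnM.
      have -> : ((size g).-1 < size g - size m)%N = false by lia.
      have -> : ((size g).-1 - (size g - size m))%N = (size m).-1 by lia.
      by rewrite -/(lead_coef g) -/(lead_coef m); ring.
    have {}gj : (size g <= j)%N by rewrite -(prednK g_gt0).
    have jm : (size m <= j - (size g - size m))%N by lia.
    rewrite (nth_default _ gj) (nth_default _ jm).
    by rewrite if_same !mulr0 addr0.
  have hz : h.[z] = 0 by rewrite /h hornerD !hornerM gz mz !mulr0 addr0.
  have /eqP := IHk h hk hA hz.
  have qmA : q * m \is a polyOver A by rewrite rpredM.
  have Tqm : T (q * m) = 0 by rewrite TM // Tm mz !mulr0 addr0.
  have TNqm : T ((-1)%:P * (q * m)) = 0.
    by rewrite TM // Tqm hornerM mz !mulr0 addr0.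
  have NqmA : (-1)%:P * (q * m) \is a polyOver A by rewrite rpredM.
  have cgA : (lead_coef m)%:P * g \is a polyOver A by rewrite rpredM.
  rewrite (TD _ _ cgA NqmA) TNqm (TM _ _ lmA gA) gz hornerC mulr0 add0r addr0.
  rewrite mulf_eq0 lead_coef_eq0 (negPf m_neq0).
  by move/eqP.
pose d' x := if pselect (exists2 g, g \is a polyOver A & x = g.[z]) is left ex
  then T (s2val (cid2 ex)) else 0.
have d'E g : g \is a polyOver A -> d' g.[z] = T g.
  move=> gA; rewrite /d'; case: pselect => [ex|[]]; last by exists g.
  case: cid2 => h hA ghz /=; have N1A : (-1)%:P \is a polyOver A.
    by rewrite polyOverC rpredN1.
  have NgA : (-1)%:P * g \is a polyOver A by rewrite rpredM.
  have : T (h + (-1)%:P * g) = 0.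
    apply: T_wd; first by rewrite rpredD.
    by rewrite hornerD hornerM hornerC mulN1r -ghz subrr.
  rewrite (TD _ _ hA NgA) (TM _ _ N1A gA) TC derivation_onN1 mul0r add0r.
  rewrite hornerC mulN1r.
  by move/eqP; rewrite subr_eq0 => /eqP.
exists d'; split; last first.
  by move=> x xA; rewrite -[x in LHS](hornerC _ z) d'E ?polyOverC.
split=> _ _ /asboolP[g gA ->] /asboolP[h hA ->].
  by rewrite -hornerD !d'E ?rpredD // TD.
by rewrite -hornerM !d'E ?rpredM // TM.
Qed.
End DerivationOn.

Section AlgebraicExtension.
Variables (L : fieldType) (L_char0 : [pchar L] =i pred0).

Lemma alg_over_sub (A B : subringClosed L) z :
  {subset A <= B} -> alg_over A z -> alg_over B z.
Proof.
move=> AB [g [gA g0 gz]]; exists g; split=> //.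
by apply: polyOverS gA => x /AB.
Qed.

Lemma adjoin_seq_derivation (A : subringClosed L) (d : L -> L) (zs : seq L) :
    derivation_on A d -> (forall z, z \in zs -> alg_over A z) ->
  exists (B : subringClosed L) (d' : L -> L), [/\ {subset A <= B},
    {subset zs <= B}, derivation_on B d' & {in A, d' =1 d}].
Proof.
move=> hd; elim: zs => [|z zs IHzs] alg_zs; first by exists A, d; split.
have [y y_zs|B [d' [AB zsB hd' d'd]]] := IHzs.
  by apply: alg_zs; rewrite inE y_zs orbT.
have [|d'' [hd'' d''d']] := adjoin_derivation hd' L_char0 (z := z).
  by apply: alg_over_sub AB _; apply: alg_zs; rewrite mem_head.
exists (adjoin B z : subringClosed L), d''; split=> //.
- by move=> x /AB; exact: sub_adjoin.
- move=> x; rewrite inE => /predU1P[->|/zsB]; [exact: adjoin_gen|].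
  exact: sub_adjoin.
- by move=> x xA; rewrite d''d' ?d'd //; apply: AB.
Qed.

(** The value at [z] of an extension is read off a fixed relation of [z], so it
    does not depend on the subring on which the extension is defined. The
    derivation rules for [x] and [y] then follow from an extension to a subring
    containing [x], [y], [x + y] and [x * y]. *)
Theorem algebraic_derivation (A : subringClosed L) (d : L -> L) :
    derivation_on A d -> (forall z, alg_over A z) ->
  exists2 d' : L -> L, derivation d' & {in A, d' =1 d}.
Proof.
move=> hd alg.
have [m mP] := choice (fun z => separable_relation L_char0 (alg z)).
pose d' z := - (map_poly d (m z)).[z] / (m z)^`().[z].
have d'E (B : subringClosed L) (dB : L -> L) z : {subset A <= B} ->
    derivation_on B dB -> {in A, dB =1 d} -> z \in B -> dB z = d' z.
  move=> AB hdB dBd zB; have [mA mz dmz _] := mP z.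
  have := derivation_on_horner hdB (polyOverS AB mA) zB.
  rewrite mz (derivation_on0 hdB) (_ : map_poly dB (m z) = map_poly d (m z)).
    move/esym/eqP; rewrite addrC addr_eq0 => /eqP dzE.
    by rewrite /d' -dzE mulrAC mulfV // mul1r.
  apply/polyP => i; rewrite (coef_map_derivation hdB) (coef_map_derivation hd).
  by apply: dBd; exact: (polyOverP mA).
exists d'; last by move=> x xA; rewrite -(d'E A d).
split=> x y; have [B [dB [AB zsB hdB dBd]]] :=
  adjoin_seq_derivation (zs := [:: x; y; x + y; x * y]) hd (fun z _ => alg z).
all: have [Bx By] : x \in B /\ y \in B
  by split; apply: zsB; rewrite !inE eqxx ?orbT.
  by rewrite -!(d'E B dB) ?rpredD ?hdB.1.
by rewrite -!(d'E B dB) ?rpredM ?hdB.2.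
Qed.
End AlgebraicExtension.

Lemma derivationN1 (R : pzRingType) (d : R -> R) : derivation d -> d (-1) = 0.
Proof.
move=> hd; apply: (@addIr _ (d 1)); rewrite -hd.1 addNr.
by rewrite (derivation0 hd) (derivation1 hd) addr0.
Qed.

(** A kernel stable under [d] is all that the quotient rule needs to be
    independent of the chosen fractions. *)
Lemma fraction_derivation (R : comNzRingType) (L : fieldType)
    (phi : {rmorphism R -> L}) (d : R -> R) :
    derivation d -> (forall x, exists a b, phi b != 0 /\ x = phi a / phi b) ->
    (forall a, phi a = 0 -> phi (d a) = 0) ->
  exists2 D : L -> L, derivation D & forall a, D (phi a) = phi (d a).
Proof.
move=> hd frac d0.
have /choice[num /choice[den xE]] := frac.
pose D x := (phi (d (num x)) - x * phi (d (den x))) / phi (den x).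
have DE a b : phi b != 0 ->
    D (phi a / phi b) = (phi (d a) * phi b - phi a * phi (d b)) / phi b ^+ 2.
  move=> b0; have [] := xE (phi a / phi b); rewrite /D.
  set x := phi a / phi b; move: (num x) (den x) => a' b' b'0 xab.
  have ab' : phi a' = phi a * phi b' / phi b by rewrite mulrAC -/x xab divfK.
  have : phi (a * b' - a' * b) = 0.
    by rewrite rmorphB !rmorphM ab' divfK // subrr.
  move/d0; rewrite -mulN1r hd.1 !hd.2 (derivationN1 hd) mul0r add0r.
  rewrite !(rmorphD, rmorphM, rmorphN1) mulN1r => /eqP.
  rewrite subr_eq0 ab'.
  rewrite -(inj_eq (addIr (- (phi a * phi b' / phi b * phi (d b))))).
  rewrite addrK => /eqP/esym/(canRL (mulfK b0)) ->; rewrite /x.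
  by field; rewrite b0.
exists D; last first.
  move=> a; have := DE a 1; rewrite rmorph1 divr1 expr1n oner_eq0.
  by move=> -> //; rewrite (derivation1 hd) rmorph0 mulr0 subr0 divr1 mulr1.
split=> x y; have [a [b [b0 ->]]] := frac x; have [a' [b' [b'0 ->]]] := frac y.
  have -> : phi a / phi b + phi a' / phi b' =
      phi (a * b' + a' * b) / phi (b * b').
    by rewrite rmorphD !rmorphM; field; rewrite b0 b'0.
  rewrite !DE ?rmorphM ?mulf_neq0 // hd.1 !hd.2 !(rmorphD, rmorphM).
  by field; rewrite b0 b'0.
have -> : phi a / phi b * (phi a' / phi b') = phi (a * a') / phi (b * b').
  by rewrite !rmorphM; field; rewrite b0 b'0.
rewrite !DE ?rmorphM ?mulf_neq0 // !hd.2 !(rmorphD, rmorphM).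
by field; rewrite b0 b'0.
Qed.

(** * Generically reduced components *)

(** Take a maximal subset among those disjoint from [T] and closed under
    addition and under multiplication by [R]. The empty set is one of them, but a maximal
    one contains [0]; it is then prime, because enlarging it by an element
    outside of it meets [T] and [T] is closed under products. *)
Lemma prime_avoidance (R : comPzRingType) (T : R -> Prop) :
    T 1 -> (forall x y, T x -> T y -> T (x * y)) -> ~ T 0 ->
  exists Q : prime_ideal R, forall x, x \in Q -> ~ T x.
Proof.
move=> T1 TM T0.
pose good (X : set R) := [/\ forall x y, X x -> X y -> X (x + y),
  forall a x, X x -> X (a * x) & forall x, X x -> ~ T x].
have chain F : (F `<=` good)%classic -> total_on F subset ->
    good (\bigcup_(X in F) X)%classic.
  move=> Fgood Ftot; split.
  - move=> x y [X FX Xx] [Y FY Yy]; have [XY|YX] := Ftot _ _ FX FY.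
      exists Y => //; case: (Fgood _ FY) => YD _ _.
      by apply: YD => //; apply: XY.
    exists X => //; case: (Fgood _ FX) => XD _ _.
    by apply: XD => //; apply: YX.
  - move=> a x [X FX Xx]; exists X => //.
    by case: (Fgood _ FX) => _ XM _; apply: XM.
  - by move=> x [X FX Xx]; case: (Fgood _ FX) => _ _; apply.
have [A [[AD AM AT] Amax]] := Zorn_bigcup chain.
have A0 : A 0.
  apply: contrapT => nA0; apply: (Amax [set 0]%classic).
    split=> [x Ax|]; last by move=> /(_ 0 erefl).
    by case: nA0; rewrite -(mul0r x); apply: AM.
  split=> [_ _ -> ->|a _ ->|_ -> //]; first by rewrite /= addr0.
  by rewrite /= mulr0.
have meet a : ~ A a -> exists x r, A x /\ T (x + r * a).
  move=> nAa; apply: contrapT => noT.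
  apply: (Amax [set y | exists x r, A x /\ y = x + r * a]%classic).
    split=> [x Ax|]; first by exists x, 0; rewrite mul0r addr0.
    move=> subA; apply: nAa; apply: subA.
    by exists 0, 1; rewrite mul1r add0r.
  split.
  - move=> x' y' [x [r [Ax ->]]] [y [s [Ay ->]]].
    by exists (x + y), (r + s); split; [exact: AD | ring].
  - move=> b x' [x [r [Ax ->]]].
    by exists (b * x), (b * r); split; [exact: AM | ring].
  - move=> x' [x [r [Ax ->]]] Txr.
    by apply: noT; exists x, r.
pose mA : {pred R} := fun x => `[< A x >].
have mA0 : 0 \in mA by apply/asboolP.
have mAD : {in mA &, forall x y, x + y \in mA}.
  by move=> x y /asboolP Ax /asboolP Ay; apply/asboolP; apply: AD.
have mAM a : {in mA, forall x, a * x \in mA}.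
  by move=> x /asboolP Ax; apply/asboolP; apply: AM.
pose I := Ideal mA0 mAD mAM.
have I1 : 1 \notin I by apply/asboolP => /AT.
have IM a b : a * b \in I -> a \in I \/ b \in I.
  move=> /asboolP Aab; apply: contrapT => /not_orP[na nb].
  have [x [r [Ax Tx]]] := meet a (fun h => na (asboolT h)).
  have [y [s [Ay Ty]]] := meet b (fun h => nb (asboolT h)).
  apply: (AT _ _ (TM _ _ Tx Ty)).
  have -> : (x + r * a) * (y + s * b) =
      (y + s * b) * x + r * a * y + r * s * (a * b).
    by ring.
  by apply: (AD _ _); [apply: (AD _ _)|]; apply: (AM _ _).
by exists (PrimeIdeal I1 IM) => x /asboolP Ax; apply: AT.
Qed.

(** By minimality [P] is the only prime of its localization, so its elements are
    nilpotent there, and reducedness makes them zero. In terms of primes of [R]: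
    otherwise the multiplicative set of the [s * a ^+ k], with [s] outside [P],
    would avoid [0], and a prime avoiding it would be strictly smaller than
    [P]. *)
Lemma generic_annihilator (R : comPzRingType) (P : prime_ideal R) :
    minimal_prime P -> reduced (localization P) ->
  forall a, a \in P -> exists2 s, s \notin P & s * a = 0.
Proof.
move=> Pmin Pred a aP; apply: contrapT => no_s.
pose T x := exists s k, s \notin P /\ x = s * a ^+ k.
have [||[s [k [sP /esym sak0]]]|Q QT] := @prime_avoidance R T.
- by exists 1, 0%N; rewrite mulr1 prime_ideal1.
- move=> _ _ [s [k [sP ->]]] [t [l [tP ->]]]; exists (s * t), (k + l)%N.
  split; last by rewrite exprD; ring.
  by apply/negP => /prime_idealM[]; apply/negP.
- have powE j : (locfrac a (locden1 P)) ^+ j = locfrac (a ^+ j) (locden1 P).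
    elim: j => [//|j IHj]; rewrite exprS IHj [LHS]loc_mulE exprS.
    by apply/locfrac_eq; exists (locden1 P); rewrite ?lvalM ?lval1; ring.
  have /Pred/locfrac_eq[r] : (locfrac a (locden1 P)) ^+ k = 0.
    rewrite powE; apply/locfrac_eq; exists (exist _ s sP).
    by rewrite lval1 mul0r subr0 mulr1.
  rewrite lval1 mul0r subr0 mulr1 => ra0; apply: no_s.
  by exists (lval r) => //; exact: (svalP r).
have QP : {subset Q <= P}.
  move=> x xQ; apply: contrapT => /negP xP; apply: (QT x xQ).
  by exists x, 0%N; rewrite mulr1.
apply: (QT a); first exact: Pmin QP _ aP.
by exists 1, 1%N; rewrite mul1r prime_ideal1.
Qed.

(** * Polynomial rings and partial derivatives *)

Section PolynomialInduction.
Variables (K : comNzRingType) (V : choiceType).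
Local Notation pol := {malg K[{cmonom V}]}.

Lemma malg_ind (T : pol -> Prop) :
    (forall c, T c%:MP) -> (forall v, T (pvar K v)) ->
    (forall p q, T p -> T q -> T (p + q)) ->
    (forall p q, T p -> T q -> T (p * q)) ->
  forall p, T p.
Proof.
move=> TC TX TD TM p; have [s ->] := malg_sum p.
elim: s => [|[c m] s IHs]; first by rewrite big_nil -malgC0E; apply: TC.
rewrite big_cons; apply: (TD _ _ _ IHs) => {p s IHs} /=.
have -> : << c *g m >> = c%:MP * << m >> :> pol.
  by rewrite malgUM mulr1 mul1m.
apply: (TM _ _ (TC c)) => {c}.
have [k] := ubnP (mdeg m); elim: k m => // k IHk m; rewrite ltnS => mk.
have [->|m1] := eqVneq m mone; first exact: TC.
have [v mv] : exists v, m v != 0%N.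
  apply: contrapT => no_v; case/eqP: m1; apply/eqP/cmP => v.
  by rewrite cm1; apply: contrapT => /eqP mv; apply: no_v; exists v.
have mE : m = mmul (divcm m (ucm v)) (ucm v).
  apply/eqP/cmP => w; rewrite cmM divcmE cmU.
  by case: eqVneq => [<-|_]; rewrite ?subn0 ?addn0 // subnK // lt0n.
have -> : << m >> = << divcm m (ucm v) >> * << ucm v >> :> pol.
  by rewrite malgUM mulr1 -mE.
apply: (TM _ _ _ (TX v)); apply: IHk; apply: leq_trans mk.
by rewrite [in ltnRHS]mE mdegM mdegU addn1.
Qed.

Lemma pderivC v c : pderiv v (c%:MP : pol) = 0.
Proof.
rewrite pderivU cm1 mulr0n; exact: monalgU0.
Qed.

Lemma pderiv_pvar v w : pderiv v (pvar K w) = (v == w)%:R :> pol.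
Proof.
rewrite pderivU cmU eq_sym; case: eqVneq => [->|_]; last first.
  by rewrite mulr0n; exact: monalgU0.
rewrite !mulr1n; suff e : divcm (ucm w) (ucm w) = mone :> {cmonom V}.
  exact: (f_equal (mkmalgU^~ 1) e).
by apply/eqP/cmP => i; rewrite divcmE subnn cm1.
Qed.
Lemma pderivM v (p q : pol) :
  pderiv v (p * q) = pderiv v p * q + p * pderiv v q.
Proof. exact: (pderiv_derivation K v).2. Qed.
End PolynomialInduction.

Section Evaluation.
Variables (K S : comNzRingType) (V : choiceType).
Variables (f : {rmorphism K -> S}) (e : V -> S).

Lemma monom_evalEw (E : {fset V}) (m : {cmonom V}) : (finsupp m `<=` E)%fset ->
  monom_eval e m = \prod_(v <- E) e v ^+ m v.
Proof.
move=> mE; apply: big_fset_incl => // v _.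
by rewrite -cmE_eq0 => /eqP->; rewrite expr0.
Qed.

Fact monom_eval_mmorphism : mmorphism (monom_eval e).
Proof.
split=> [m k|]; last by rewrite /monom_eval mdom1 big_seq_fset0.
rewrite (@monom_evalEw (finsupp m `|` finsupp k)%fset) ?mdomD //.
rewrite (@monom_evalEw (finsupp m `|` finsupp k)%fset m) ?fsubsetUl //.
rewrite (@monom_evalEw (finsupp m `|` finsupp k)%fset k) ?fsubsetUr //.
by rewrite -big_split; apply: eq_bigr => v _; rewrite cmM exprD.
Qed.

HB.instance Definition _ :=
  monalg.isMultiplicative.Build {cmonom V} S (monom_eval e)
    monom_eval_mmorphism.

HB.instance Definition _ :=
  GRing.RMorphism.copy (peval f e) (mmap f (monom_eval e)).

Lemma pevalC c : peval f e c%:MP = f c.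
Proof. exact: mmapC. Qed.

Lemma peval_pvar v : peval f e (pvar K v) = e v.
Proof.
transitivity (f 1 * monom_eval e (ucm v)); first exact: mmapU.
rewrite rmorph1 mul1r /monom_eval mdomU big_seq_fset1 cmUU.
exact: expr1.
Qed.
End Evaluation.

(** Polynomials are generated by constants and variables, can be evaluated, and
    have partial derivatives. The arguments below use only this, and are carried
    out for an abstract ring with these properties, independently of any
    description by coefficients and monomials. *)
Record polyring (K : comNzRingType) (V : eqType) := PolyRing {
  pr :> comNzRingType;
  prC : {rmorphism K -> pr};
  prX : V -> pr;
  prD : V -> pr -> pr;
  pr_ind : forall T : pr -> Prop,
    (forall c, T (prC c)) -> (forall v, T (prX v)) ->
    (forall p q, T p -> T q -> T (p + q)) ->
    (forall p q, T p -> T q -> T (p * q)) -> forall p, T p;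
  pr_univ : forall (S : comNzRingType) (f : {rmorphism K -> S}) (e : V -> S),
    exists g : {rmorphism pr -> S},
      (forall c, g (prC c) = f c) /\ (forall v, g (prX v) = e v);
  prD_derivation : forall v, derivation (prD v);
  prDC : forall v c, prD v (prC c) = 0;
  prDX : forall v w, prD v (prX w) = (v == w)%:R
}.

Section MalgPolyring.
Variables (K : comNzRingType) (V : choiceType).
Local Notation pol := {malg K[{cmonom V}]}.

Fact malg_univ (S : comNzRingType) (f : {rmorphism K -> S}) (e : V -> S) :
  exists g : {rmorphism pol -> S},
    (forall c, g c%:MP = f c) /\ (forall v, g (pvar K v) = e v).
Proof.
exists (peval f e : {rmorphism pol -> S}).
by split=> [c|v]; [exact: pevalC | exact: peval_pvar].
Qed.

Definition malg_polyring : polyring K V :=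
  @PolyRing K V pol (@malgC _ K) (@pvar K V) (@pderiv K V)
    (@malg_ind K V) malg_univ (@pderiv_derivation K V) (@pderivC K V)
    (@pderiv_pvar K V).
End MalgPolyring.

Definition derivation_along (R S : pzRingType) (phi d : R -> S) : Prop :=
  {morph d : x y / x + y} /\ forall x y, d (x * y) = d x * phi y + phi x * d y.

Section PolyringTheory.
Variables (K : comNzRingType) (V : choiceType) (A : polyring K V).
Implicit Types p q : A.

Lemma polyring_rmorphism_eq (S : pzRingType) (phi psi : {rmorphism A -> S}) :
    (forall c, phi (prC A c) = psi (prC A c)) ->
    (forall v, phi (prX A v) = psi (prX A v)) ->
  phi =1 psi.
Proof.
move=> eqC eqX p; elim/(@pr_ind K V A): p => // p q IHp IHq.
  by rewrite !rmorphD IHp IHq.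
by rewrite !rmorphM IHp IHq.
Qed.

Lemma prDD v : {morph @prD K V A v : p q / p + q}.
Proof. exact: (prD_derivation A v).1. Qed.

Lemma prDM v p q : prD v (p * q) = prD v p * q + p * prD v q.
Proof. exact: (prD_derivation A v).2. Qed.

Lemma prD_finite p : exists E : {fset V}, forall v, v \notin E -> prD v p = 0.
Proof.
elim/(@pr_ind K V A): p => [c|w|p q [E pE] [F qF]|p q [E pE] [F qF]].
- by exists fset0 => v _; rewrite prDC.
- by exists [fset w]%fset => v; rewrite in_fset1 prDX => /negPf->.
- exists (E `|` F)%fset => v; rewrite in_fsetU negb_or => /andP[vE vF].
  by rewrite prDD pE // qF // addr0.
- exists (E `|` F)%fset => v; rewrite in_fsetU negb_or => /andP[vE vF].
  by rewrite prDM pE // qF // mul0r mulr0 addr0.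
Qed.

(** Both sides are derivations along [phi] that agree on constants and
    variables. The sum is made independent of the polynomial by letting it run
    over any finite set containing a suitable one. *)
Theorem chain_rule (S : comNzRingType) (phi : {rmorphism A -> S}) (d : A -> S) :
    derivation_along phi d -> (forall c, d (prC A c) = 0) ->
  forall p (E : {fset V}), (forall v, v \notin E -> prD v p = 0) ->
  d p = \sum_(v <- E) phi (prD v p) * d (prX A v).
Proof.
move=> [dD dM] dC p E pE.
pose formula q := exists E0 : {fset V}, forall E, (E0 `<=` E)%fset ->
  d q = \sum_(v <- E) phi (prD v q) * d (prX A v).
suff [E0 /(_ (E `|` E0)%fset (fsubsetUr _ _)) ->] : formula p.
  apply: esym; apply: big_fset_incl; first exact: fsubsetUl.
  by move=> v _ vE; rewrite pE // rmorph0 mul0r.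
elim/(@pr_ind K V A): p {E pE} => [c|w|p q [E0 pE] [E1 qE]|p q [E0 pE] [E1 qE]].
- exists fset0 => E _; rewrite dC big1 // => v _.
  by rewrite prDC rmorph0 mul0r.
- exists [fset w]%fset => E; rewrite fsub1set => wE.
  rewrite (big_fsetD1 w) //= prDX eqxx rmorph1 mul1r.
  rewrite big_seq big1 ?addr0 // => v; rewrite in_fsetD1 => /andP[/negPf vw _].
  by rewrite prDX vw rmorph0 mul0r.
- exists (E0 `|` E1)%fset => E; rewrite fsubUset => /andP[E0E E1E].
  rewrite dD (pE E E0E) (qE E E1E) -big_split; apply: eq_bigr => v _ /=.
  by rewrite prDD rmorphD mulrDl.
- exists (E0 `|` E1)%fset => E; rewrite fsubUset => /andP[E0E E1E].
  rewrite dM (pE E E0E) (qE E E1E) mulr_suml mulr_sumr -big_split.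
  apply: eq_bigr => v _ /=; rewrite prDM rmorphD !rmorphM.
  by rewrite mulrDl mulrAC mulrA.
Qed.
End PolyringTheory.

Lemma chain_rule_fin (K S : comNzRingType) (V : choiceType) (A : polyring K V)
    (phi : {rmorphism A -> S}) (d : A -> S) (Z : finType) (iota : Z -> V) :
    derivation_along phi d -> (forall c, d (prC A c) = 0) -> injective iota ->
  forall p, (forall v, (forall z, v != iota z) -> prD v p = 0) ->
  d p = \sum_z phi (prD (iota z) p) * d (prX A (iota z)).
Proof.
move=> hd dC iota_inj p p_supp; pose E := seq_fset tt (map iota (enum Z)).
rewrite (@chain_rule _ _ _ _ _ _ hd dC p E) => [|v]; last first.
  rewrite seq_fsetE => vE; apply: p_supp => z; apply: contraNneq vE => ->.
  by rewrite map_f ?mem_enum.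
transitivity (\sum_(v <- map iota (enum Z)) phi (prD v p) * d (prX A v)).
  apply: perm_big; apply: uniq_perm => [||v].
  - exact: fset_uniq.
  - by rewrite map_inj_uniq ?enum_uniq.
  - exact: seq_fsetE.
by rewrite big_map big_enum.
Qed.

(** The commutation of the partial derivatives with the derivation of
    differential polynomials: [x_i^(s)] occurs in the derivative of
    [x_i^(s - 1)]. *)
Lemma prD_shift_derivation (K : comNzRingType) (n : nat)
    (A : polyring K ('I_n * nat)%type) (d : K -> K) (del : A -> A) :
    derivation del -> (forall c, del (prC A c) = prC A (d c)) ->
    (forall i s, del (prX A (i, s)) = prX A (i, s.+1)) ->
  forall i s p, prD (i, s) (del p) =
    del (prD (i, s) p) + (if s is s'.+1 then prD (i, s') p else 0).
Proof.
move=> hdel delC delX i s p; have [delD delM] := hdel.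
have del0 := derivation0 hdel; have del1 : del 1 = 0 := derivation1 hdel.
elim/(@pr_ind _ _ A): p => [c|[j t]|p q IHp IHq|p q IHp IHq].
- rewrite delC !prDC del0 add0r; case: s => // s.
  by rewrite prDC.
- rewrite delX !prDX.
  have -> (b : bool) : del b%:R = 0 by case: b; rewrite ?del0 ?del1.
  case: s => [|s]; rewrite add0r ?prDX !xpair_eqE ?eqSS //.
  by rewrite andbF.
- rewrite delD !prDD IHp IHq delD addrACA; congr (_ + _).
  by case: s {IHp IHq} => [|s]; rewrite ?addr0 ?prDD.
- rewrite delM prDD !prDM IHp IHq delD !delM.
  by case: s {IHp IHq} => [|s]; rewrite ?prDM; ring.
Qed.

(** * Algebraic relations and transcendence bases *)

Section NonsingularRelation.
Variables (K L : fieldType) (f : {rmorphism K -> L}).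
Variables (V : choiceType) (e : V -> L).
Hypothesis K_char0 : [pchar K] =i pred0.
Local Notation pol := {malg K[{cmonom V}]}.

Lemma pderiv_eq0_const (p : pol) :
  (forall v, pderiv v p = 0) -> p = (p@_mone)%:MP.
Proof.
move=> dp0; apply/malgP => m; rewrite [RHS]mcoeffC.
case: eqVneq => [->|m1]; rewrite ?mulr1n // mulr0n.
have [v mv] : exists v, m v != 0%N.
  apply: contrapT => no_v; case/eqP: m1; apply/eqP/cmP => v.
  by rewrite cm1; apply: contrapT => /eqP mv; apply: no_v; exists v.
have mE : m = mmul (divcm m (ucm v)) (ucm v).
  apply/eqP/cmP => w; rewrite cmM divcmE cmU.
  by case: eqVneq => [<-|_]; rewrite ?subn0 ?addn0 // subnK // lt0n.
have := mcoeff_pderiv v p (divcm m (ucm v)); rewrite dp0 mcoeff0 -mE.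
move/esym/eqP; rewrite -mulr_natr mulf_eq0 (pcharf0P K).1 // orbF.
by move/eqP.
Qed.

Lemma msize_pderiv v (p : pol) k :
  (msize p <= k.+1)%N -> (msize (pderiv v p) <= k)%N.
Proof.
move=> pk; rewrite msizeE big_seq; elim/big_ind: _ => // [x y xk yk|m].
  by rewrite geq_max xk yk.
rewrite -mcoeff_neq0 mcoeff_pderiv => dpm.
have : mmul m (ucm v) \in msupp p.
  by rewrite -mcoeff_neq0; apply: contra_neq dpm => ->; rewrite mul0rn.
by move/msize_mdeg_lt; rewrite mdegM mdegU addn1 => /leq_trans/(_ pk).
Qed.

(** As long as all partial derivatives of a relation vanish at the point, a
    nonzero one among them is a relation of smaller degree; the process stops
    before reaching a constant. *)
Lemma nonsingular_relation (p : pol) : p != 0 -> peval f e p = 0 ->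
  exists2 q : pol, peval f e q = 0 & exists v, peval f e (pderiv v q) != 0.
Proof.
have [k] := ubnP (msize p); elim: k p => // k IHk p pk p0 ep.
have [[v dvp]|no_v] := pselect (exists v, peval f e (pderiv v p) != 0).
  by exists p => //; exists v.
have [[v dvp]|dp0] := pselect (exists v, pderiv v p != 0); last first.
  have pE : p = (p@_mone)%:MP.
    apply: pderiv_eq0_const => v; apply: contrapT => /eqP dvp.
    by apply: dp0; exists v.
  move: ep p0; rewrite pE pevalC => /eqP; rewrite fmorph_eq0 => /eqP->.
  by rewrite malgC0E eqxx.
apply: (IHk (pderiv v p)) => //; last first.
  by apply: contrapT => /eqP edvp; apply: no_v; exists v.
case: k {IHk} pk => [|k] pk; last exact: msize_pderiv.
by move: p0; rewrite -msize_eq0 -leqn0 -ltnS pk.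
Qed.
End NonsingularRelation.

Lemma alg_dependent (K L : fieldType) (f : {rmorphism K -> L}) k
    (e : 'I_k -> L) : ~ alg_independent f e ->
  exists2 p : {malg K[{cmonom 'I_k}]}, p != 0 & peval f e p = 0.
Proof.
move=> dep; apply: contrapT => no_p; apply: dep => p ep.
by apply: contrapT => /eqP p0; apply: no_p; exists p.
Qed.

(** A nonsingular relation between the values of a few variables, read as a
    polynomial in the full set of variables, has a nonzero differential at the
    point supported on these variables only. Applied to the derivatives of a
    single indeterminate, it decouples the linearized equations. *)
Lemma sparse_relation (K L : fieldType) (f : {rmorphism K -> L})
    (K_char0 : [pchar K] =i pred0) (V : choiceType) (A : polyring K V)
    (phi : {rmorphism A -> L}) k (iota : 'I_k -> V) :
    (forall c, phi (prC A c) = f c) -> injective iota ->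
    ~ alg_independent f (fun i => phi (prX A (iota i))) ->
  exists p : A, [/\ phi p = 0, exists i, phi (prD (iota i) p) != 0
    & forall v, (forall i, v != iota i) -> phi (prD v p) = 0].
Proof.
move=> phiC iota_inj /alg_dependent[p0 p0_neq0 ep0].
have [] := nonsingular_relation K_char0 p0_neq0 ep0.
move: (malg_univ f (fun i => phi (prX A (iota i)))).
suff gen (B : polyring K 'I_k) (ev : {rmorphism B -> L}) (q : B) :
    (forall c, ev (prC B c) = f c) ->
    (forall i, ev (prX B i) = phi (prX A (iota i))) -> ev q = 0 ->
    (exists i, ev (prD i q) != 0) -> exists p : A, [/\ phi p = 0,
    exists i, phi (prD (iota i) p) != 0
    & forall v, (forall i, v != iota i) -> phi (prD v p) = 0].
  move=> _ q evq devq.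
  apply: (gen (malg_polyring K 'I_k)
    (peval f (fun i => phi (prX A (iota i))) : {rmorphism _ -> L}) q)
    => // [c|i].
    exact: pevalC.
  exact: peval_pvar.
move=> evC evX evq [i0 devq].
have [g [gC gX]] := pr_univ B (prC A) (fun i => prX A (iota i)).
have phig : phi \o g =1 ev.
  by apply: polyring_rmorphism_eq => [c|i] /=; rewrite ?gC ?phiC ?evC // gX evX.
have Dg v p : prD v (g p) = \sum_i g (prD i p) * (v == iota i)%:R.
  rewrite (@chain_rule_fin _ _ _ _ g (fun p => prD v (g p)) _ idfun)
    => [||||w /(_ w)].
  - by apply: eq_bigr => i _; rewrite gX prDX.
  - by split=> x y; rewrite ?rmorphD ?prDD // rmorphM prDM.
  - by move=> c; rewrite gC prDC.
  - by [].
  - by rewrite eqxx.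
exists (g q); split=> [||v vN].
- by rewrite -[LHS]phig in evq *.
- exists i0; rewrite Dg (bigD1 i0) //= eqxx mulr1 big1 ?addr0.
    by rewrite [phi _]phig.
  by move=> i ii0; rewrite (inj_eq iota_inj) eq_sym (negPf ii0) mulr0.
- by rewrite Dg big1 ?rmorph0 // => i _; rewrite (negPf (vN i)) mulr0.
Qed.

Definition rimage (R : comNzRingType) (L : fieldType) (g : {rmorphism R -> L}) :
  {pred L} := fun x => `[< exists p, x = g p >].

Section RingImage.
Variables (R : comNzRingType) (L : fieldType) (g : {rmorphism R -> L}).

Fact rimage_subring_closed : subring_closed (rimage g).
Proof.
split=> [|x y /asboolP[p ->] /asboolP[q ->]|x y /asboolP[p ->] /asboolP[q ->]];
  apply/asboolP.
- by exists 1; rewrite rmorph1.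
- by exists (p - q); rewrite rmorphB.
- by exists (p * q); rewrite rmorphM.
Qed.

HB.instance Definition _ :=
  GRing.isSubringClosed.Build L (rimage g) rimage_subring_closed.

Lemma mem_rimage p : g p \in rimage g.
Proof. by apply/asboolP; exists p. Qed.
End RingImage.

Section TranscendenceDerivation.
Variables (K L : fieldType) (f : {rmorphism K -> L}) (r : nat).

Definition extend (e : 'I_r -> L) (z : L) (i : 'I_r.+1) : L :=
  if unlift ord_max i is Some j then e j else z.

(** A polynomial in [r + 1] variables is a polynomial in the last variable over
    the ring of polynomials in the others: [th] is this isomorphism, with left
    inverse given by [h]. A relation between [e] and [z] thus becomes a nonzero
    polynomial over [K[e]] with root [z], because [ev] is injective. *)
Lemma dependent_alg_over (B : polyring K 'I_r) (B' : polyring K 'I_r.+1)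
    (ev : {rmorphism B -> L}) (ev' : {rmorphism B' -> L})
    (e : 'I_r -> L) (z : L) (p : B') :
    (forall c, ev (prC B c) = f c) -> (forall i, ev (prX B i) = e i) ->
    (forall c, ev' (prC B' c) = f c) ->
    (forall i, ev' (prX B' i) = extend e z i) ->
    injective ev -> p != 0 -> ev' p = 0 ->
  alg_over (rimage ev) z.
Proof.
move=> evC evX evC' evX' ev_inj p0 ep0.
have [th [thC thX]] := pr_univ B'
  ((polyC : {rmorphism B -> {poly B}}) \o prC B)
  (fun i => if unlift ord_max i is Some j then (prX B j)%:P else 'X).
have [h [hC hX]] := pr_univ B (prC B') (fun j => prX B' (lift ord_max j)).
have thK : (horner_eval (prX B' ord_max) \o map_poly h) \o th =1 idfun.
  apply: polyring_rmorphism_eq => [c|i] /=.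
    by rewrite thC /= map_polyC /= hC /horner_eval hornerC.
  rewrite thX; case: unliftP => [j ->|->] /=.
    by rewrite map_polyC /= hX /horner_eval hornerC.
  by rewrite map_polyX /horner_eval hornerX.
have evE : (horner_eval z \o map_poly ev) \o th =1 ev'.
  apply: polyring_rmorphism_eq => [c|i] /=.
    by rewrite thC /= map_polyC /= evC evC' /horner_eval hornerC.
  rewrite thX evX' /extend; case: unliftP => [j _|_] /=.
    by rewrite map_polyC /= evX /horner_eval hornerC.
  by rewrite map_polyX /horner_eval hornerX.
exists (map_poly ev (th p)); split.
- by apply/polyOverP => i; rewrite coef_map mem_rimage.
- rewrite -(rmorph0 (map_poly ev)) (inj_eq (map_inj_poly ev_inj (rmorph0 _))).
  apply: contra_neq p0 => thp0.
  by rewrite -[p]thK /= thp0 rmorph0 /horner_eval horner0.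
- by rewrite -ep0 -evE.
Qed.

Lemma transcendence_derivation_gen (B : polyring K 'I_r)
    (ev : {rmorphism B -> L}) (L_char0 : [pchar L] =i pred0) (i0 : 'I_r) :
    injective ev -> (forall z, alg_over (rimage ev) z) ->
  exists2 D : L -> L, derivation D &
    (forall c, D (ev (prC B c)) = 0) /\
    (forall j, D (ev (prX B j)) = (i0 == j)%:R).
Proof.
move=> ev_inj alg.
pose d x := if pselect (exists p, x = ev p) is left ex
  then ev (prD i0 (projT1 (cid ex))) else 0.
have dE p : d (ev p) = ev (prD i0 p).
  rewrite /d; case: pselect => [ex|[]]; last by exists p.
  by case: cid => q /= /ev_inj->.
have hd : derivation_on (rimage ev) d.
  split=> _ _ /asboolP[p ->] /asboolP[q ->].
    by rewrite -rmorphD !dE prDD rmorphD.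
  by rewrite -rmorphM !dE prDM rmorphD !rmorphM.
have [D hD Dd] := algebraic_derivation L_char0 hd alg.
exists D => //; split=> [c|j]; rewrite Dd ?mem_rimage // dE.
  by rewrite prDC rmorph0.
by rewrite prDX; case: eqP; rewrite ?rmorph1 ?rmorph0.
Qed.

(** The partial derivative with respect to the variable [i0], transported to
    [K[e]] and extended to the algebraic extension [L] of its fraction
    field. *)
Theorem transcendence_derivation (e : 'I_r -> L) (K_char0 : [pchar K] =i pred0)
    (i0 : 'I_r) :
    alg_independent f e -> (forall z, ~ alg_independent f (extend e z)) ->
  exists2 D : L -> L, derivation D &
    (forall c, D (f c) = 0) /\ (forall j, D (e j) = (i0 == j)%:R).
Proof.
move=> e_free e_max.
have L_char0 : [pchar L] =i pred0 by move=> p; rewrite (fmorph_pchar f) K_char0.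
pose B := malg_polyring K 'I_r.
pose ev : {rmorphism B -> L} := (peval f e : {rmorphism _ -> L}).
have ev_inj : injective ev.
  move=> p q /eqP; rewrite -subr_eq0 -rmorphB => /eqP/e_free/eqP.
  by rewrite subr_eq0 => /eqP.
have alg z : alg_over (rimage ev) z.
  have /alg_dependent[p p0 ep] := e_max z.
  apply: (@dependent_alg_over B (malg_polyring K 'I_r.+1) ev
    (peval f (extend e z) : {rmorphism _ -> L}) e z p) => //; try exact: pevalC.
    exact: peval_pvar.
  exact: peval_pvar.
have [D hD [DC DX]] := transcendence_derivation_gen L_char0 i0 ev_inj alg.
exists D => //; split=> [c|j].
  by rewrite -[f c](pevalC f e); exact: DC.
by rewrite -[e j](peval_pvar f e); exact: DX.
Qed.
End TranscendenceDerivation.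

(** * The linearized system at the generic point *)

Section Prolongation.
Variables (L : fieldType) (n : nat) (D : L -> L).
Hypothesis hD : derivation D.
Local Notation V := ('I_n * nat)%type.
Local Notation covector := (V -> L^o).

(** The operator on covectors induced by the derivation of differential
    polynomials: [D] on coefficients and [dx_i^(s) |-> dx_i^(s + 1)]. *)
Definition nabla (g : covector) : covector :=
  fun v => D (g v) + (if v.2 is s.+1 then g (v.1, s) else 0).

Lemma nablaD : {morph nabla : g h / g + h}.
Proof.
move=> g h; apply/funext => -[i s]; rewrite /nabla /= !fctE hD.1.
by case: s => [|s]; rewrite ?addr0 ?fctE //= addrACA.
Qed.

Lemma nablaZ a g : nabla (a *: g) = D a *: g + a *: nabla g.
Proof.
apply/funext => -[i s]; rewrite /nabla !fctE /= hD.2 -addrA; congr (_ + _).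
by rewrite [RHS]mulrDr; case: s => [|s]; rewrite ?mulr0.
Qed.

Lemma sum_scale_eval (I : finType) (z : I -> L) (h : I -> covector) v :
  (\sum_i z i *: h i) v = \sum_i z i * h i v.
Proof. by rewrite fct_sumE. Qed.

Section Leading.
Variables (i0 : 'I_n) (m : nat) (g : covector).
Hypothesis g_out : forall i s, (i != i0) || (m < s)%N -> g (i, s) = 0.

Lemma nabla_out t i s : (i != i0) || (m + t < s)%N -> iter t nabla g (i, s) = 0.
Proof.
elim: t i s => [|t IHt] i s is_out.
  by apply: g_out; rewrite -[m]addn0.
rewrite iterS {1}/nabla IHt ?(derivation0 hD) ?add0r; last first.
  by case/orP: is_out => [->//|ms]; apply/orP; right; lia.
case: s is_out => //= s is_out; apply: IHt.
by case/orP: is_out => [->//|ms]; apply/orP; right; lia.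
Qed.

Lemma nabla_lead t : iter t nabla g (i0, m + t)%N = g (i0, m).
Proof.
elim: t => [|t IHt]; first by rewrite addn0.
rewrite iterS {1}/nabla nabla_out ?(derivation0 hD) ?add0r ?addnS //=.
by apply/orP; right; lia.
Qed.
End Leading.

(** Each [nabla] raises the order of the leading coordinate by one and keeps its
    coefficient, so the family is triangular. *)
Lemma nabla_free (tau : 'I_n -> covector) (m : 'I_n -> nat) (T : nat) :
    (forall i j s, (j != i) || (m i < s)%N -> tau i (j, s) = 0) ->
    (forall i, tau i (i, m i) != 0) ->
  lfree (fun p : 'I_n * 'I_T => iter p.2 nabla (tau p.1)).
Proof.
move=> tau_out tau_lead z z0 [i t].
have [k] := ubnP (T - t); elim: k t => // k IHk t tk.
have /(f_equal (fun g => g (i, (m i + t)%N))) := z0.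
rewrite /= sum_scale_eval (bigD1 (i, t)) //= big1 => [|[j t'] jt] /=.
  rewrite addr0 nabla_lead; last exact: tau_out.
  by move/eqP; rewrite mulf_eq0 (negPf (tau_lead i)) orbF => /eqP.
have [ji|ji] := eqVneq j i; last first.
  by rewrite (nabla_out (tau_out j)) ?mulr0 // eq_sym ji.
rewrite ji in jt *; have [tt'|tt'|tt'] := ltngtP t t'.
- by rewrite IHk ?mul0r //; have := ltn_ord t'; lia.
- by rewrite (nabla_out (tau_out i)) ?mulr0 // ltn_add2l tt' orbT.
- by case/eqP: jt; congr pair; apply: val_inj.
Qed.
End Prolongation.

Section GenericPoint.
Variables (K L : fieldType) (f : {rmorphism K -> L}) (n : nat).
Local Notation V := ('I_n * nat)%type.
Local Notation covector := (V -> L^o).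
Variables (A : polyring K V) (del : A -> A) (u : 'I_n -> A).
Variable phi : {rmorphism A -> L}.
Hypothesis del_derivation : derivation del.
Hypothesis prD_del : forall i s p, prD (i, s) (del p) =
  del (prD (i, s) p) + (if s is s'.+1 then prD (i, s') p else 0).
Hypothesis phiC : forall c, phi (prC A c) = f c.
Hypothesis phi_frac : forall x, exists a b, phi b != 0 /\ x = phi a / phi b.
Hypothesis phi_u : forall k j, phi (iter j del (u k)) = 0.
Hypothesis phi_ker : forall p, phi p = 0 -> exists2 s, phi s != 0 &
  in_span (fun kj : V => iter kj.2 del (u kj.1)) (s * p).

Definition differential (p : A) : covector := fun v => phi (prD v p).

Lemma differentialM p q :
  differential (p * q) = phi q *: differential p + phi p *: differential q.
Proof.
apply/funext => v; rewrite /differential prDM rmorphD !rmorphM !fctE.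
by rewrite [phi (prD v p) * _]mulrC.
Qed.

Lemma differential_sum (I : Type) (r : seq I) (F : I -> A) :
  differential (\sum_(i <- r) F i) = \sum_(i <- r) differential (F i).
Proof.
apply/funext => v; rewrite fct_sumE /differential.
elim: r => [|i r IHr].
  by rewrite !big_nil (derivation0 (prD_derivation A v)) rmorph0.
by rewrite !big_cons prDD rmorphD IHr.
Qed.

Lemma phi_ker_del p : phi p = 0 -> phi (del p) = 0.
Proof.
move=> p0; have [s s0 [r spE]] := phi_ker p0.
have : phi (del (s * p)) = 0.
  rewrite spE; elim: r {spE} => [|x r IHr].
    by rewrite big_nil (derivation0 del_derivation) rmorph0.
  rewrite big_cons del_derivation.1 del_derivation.2 !rmorphD !rmorphM IHr.
  rewrite phi_u -[del (iter _ _ _)]/(iter x.2.2.+1 del _) phi_u.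
  by rewrite !mulr0 !addr0.
rewrite del_derivation.2 rmorphD !rmorphM p0 mulr0 add0r.
by move/eqP; rewrite mulf_eq0 (negPf s0) => /eqP.
Qed.

(** In [s * p = \sum c_kj * u_k^(j)] the differentials of [s] and of the [c_kj]
    are multiplied by elements vanishing at the point. *)
Lemma differential_ker_span p : phi p = 0 -> exists c, lspan
  (fun s => exists k j, (j < c)%N /\ s = differential (iter j del (u k)))
  (differential p).
Proof.
move=> p0; have [s s0 [r spE]] := phi_ker p0.
pose c := (\max_(x <- r) x.2.2).+1; exists c.
rewrite -[differential p]scale1r -(mulVf s0) -scalerA; apply: lspanZ.
have -> : phi s *: differential p =
    \sum_(x <- r) phi x.1 *: differential (iter x.2.2 del (u x.2.1)).
  have -> : phi s *: differential p = differential (s * p).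
    by rewrite differentialM p0 scale0r add0r.
  rewrite spE differential_sum; apply: eq_bigr => x _.
  by rewrite differentialM phi_u scale0r add0r.
rewrite big_seq; apply: lspan_sum => x xr; apply: lspanZ; apply: mem_lspan.
by exists x.2.1, x.2.2; split=> //; rewrite ltnS; exact: leq_bigmax_seq.
Qed.

Variable D : L -> L.
Hypothesis hD : derivation D.
Hypothesis D_phi : forall p, D (phi p) = phi (del p).

Lemma differential_del p : differential (del p) = nabla D (differential p).
Proof.
apply/funext => -[i s]; rewrite /differential /nabla prD_del rmorphD D_phi.
by case: s => [|s]; rewrite ?rmorph0.
Qed.

Lemma differential_iter j p :
  differential (iter j del p) = iter j (nabla D) (differential p).
Proof. by elim: j => //= j IHj; rewrite differential_del IHj. Qed.

Hypothesis K_char0 : [pchar K] =i pred0.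

(** The [tau] required by [rows_independent] are the differentials at the point
    of nonsingular relations between [x_i], [x_i^(1)], up to [x_i^(r)], which
    exist as the transcendence degree is at most [r]. *)
Lemma equations_independent r (N : 'I_n -> nat) :
    (forall k (e : 'I_k -> L), alg_independent f e -> (k <= r)%N) ->
  lfree (fun p : {k : 'I_n & 'I_(N k)} =>
    differential (iter (tagged p) del (u (tag p)))).
Proof.
move=> trdeg_le.
have rel i : exists p : A, [/\ phi p = 0,
    exists s, phi (prD (i, s) p) != 0 & forall j s, phi (prD (j, s) p) != 0 ->
      j = i /\ (s <= r)%N].
  have [||p [p0 [s dp] p_out]] := @sparse_relation _ _ f K_char0 _ A phi r.+1
    (fun s => (i, val s)) phiC.
  - by move=> s t [] /val_inj.
  - by move/trdeg_le; rewrite ltnn.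
  exists p; split=> //; first by exists (val s).
  move=> j t djt; apply: contrapT => nij; case/eqP: djt; apply: p_out => s'.
  by apply/eqP => -[ji ts]; apply: nij; rewrite ji ts -ltnS ltn_ord.
have [p pP] := choice rel.
have lead i : exists m, phi (prD (i, m) (p i)) != 0 /\
    forall s, phi (prD (i, s) (p i)) != 0 -> (s <= m)%N.
  have [_ ex_s p_out] := pP i.
  have s_le s : phi (prD (i, s) (p i)) != 0 -> (s <= r)%N by case/p_out.
  by have [m dm m_max] := ex_maxnP ex_s s_le; exists m.
have [m mP] := choice lead.
have span i : exists c, lspan (fun s => exists k j, (j < c)%N /\
    s = iter j (nabla D) (differential (u k))) (differential (p i)).
  have [/differential_ker_span[c cP] _ _] := pP i.
  exists c; apply: lspan_sub cP => s [k [j [jc ->]]].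
  by apply: mem_lspan; exists k, j; rewrite differential_iter.
have [c cP] := choice span.
have -> : (fun q : {k : 'I_n & 'I_(N k)} =>
      differential (iter (tagged q) del (u (tag q)))) =
    (fun q => iter (tagged q) (nabla D) (differential (u (tag q)))).
  by apply/funext => q; rewrite differential_iter.
refine (@rows_independent L _ D (nabla D) (nablaD hD) (nablaZ hD) n
  (fun k => differential (u k)) (fun i => differential (p i))
  (\max_i c i)%N _ _ N) => [T|i].
  apply: (@nabla_free _ _ _ hD (fun i => differential (p i)) m T)
    => [i j s out|i]; last exact: (mP i).1.
  apply: contrapT => /eqP dp; have [_ _ p_out] := pP i.
  have [ji _] := p_out j s dp; rewrite ji eqxx /= in out dp.
  by have := (mP i).2 s dp; rewrite leqNgt out.
apply: lspan_sub (cP i) => s [k [j [jc ->]]]; apply: mem_lspan.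
by exists k, j; split=> //; apply: leq_trans jc (leq_bigmax i).
Qed.

Lemma prD_iter_order k i b : (forall s, prD (i, s) (u k) != 0 -> (s <= b)%N) ->
  forall j s, prD (i, s) (iter j del (u k)) != 0 -> (s <= b + j)%N.
Proof.
move=> order_u; elim=> [|j IHj] s; first by rewrite addn0; exact: order_u.
rewrite iterS prD_del addnS => nz.
have [dj|dj] := eqVneq (prD (i, s) (iter j del (u k))) 0; last first.
  exact: leqW (IHj _ dj).
move: nz; rewrite dj (derivation0 del_derivation) add0r.
by case: s {dj} => [|s]; rewrite ?eqxx //= ltnS; exact: IHj.
Qed.
End GenericPoint.

(** The count of coordinates against equations, at a zero of the system given by
    its evaluation morphism [phi]; [a k i] is any bound for the order of [u k]
    in the variable [i]. *)
Theorem trdeg_le_jacobi (K L : fieldType) (f : {rmorphism K -> L}) (n : nat)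
    (A : polyring K ('I_n * nat)%type) (del : A -> A) (u : 'I_n -> A)
    (phi : {rmorphism A -> L}) (a : 'I_n -> 'I_n -> nat) (r : nat) :
    derivation del ->
    (forall i s p, prD (i, s) (del p) =
      del (prD (i, s) p) + (if s is s'.+1 then prD (i, s') p else 0)) ->
    (forall c, phi (prC A c) = f c) ->
    (forall x, exists a b, phi b != 0 /\ x = phi a / phi b) ->
    (forall k j, phi (iter j del (u k)) = 0) ->
    (forall p, phi p = 0 -> exists2 s, phi s != 0 &
      in_span (fun kj : 'I_n * nat => iter kj.2 del (u kj.1)) (s * p)) ->
    [pchar K] =i pred0 ->
    (forall k i s, prD (i, s) (u k) != 0 -> (s <= a k i)%N) ->
    has_trdeg f r ->
  (r <= \max_(s : 'S_n) \sum_i a (s i) i)%N.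
Proof.
move=> hdel prD_del phiC phi_frac phi_u phi_ker K_char0 order_u.
move=> [[e e_free] trdeg_le].
have [D hD D_phi] := fraction_derivation hdel phi_frac
  (phi_ker_del hdel phi_u phi_ker).
have [lam [mu [a_le mu_le]]] := egervary a.
have /choice[w wP] i : exists w : L -> L, derivation w /\
    ((forall c, w (f c) = 0) /\ (forall j, w (e j) = (i == j)%:R)).
  have [z /trdeg_le|w hw wfe] := transcendence_derivation K_char0 i e_free.
    by rewrite ltnn.
  by exists w.
have hw i : derivation_along phi (fun p => w i (phi p)).
  have [[wD wM] _] := wP i.
  by split=> p q; rewrite ?rmorphD ?wD // rmorphM wM.
have wC i c : w i (phi (prC A c)) = 0 by rewrite phiC; exact: (wP i).2.1.
(* [M] is large enough for the [x_i^(s)] with [s < M] to generate a field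
   containing the transcendence basis. *)
have [M [num [den numdenP]]] : exists M (num den : 'I_r -> A), forall j,
    [/\ phi (den j) != 0, e j = phi (num j) / phi (den j)
      & forall i s, (M <= s)%N ->
        prD (i, s) (num j) = 0 /\ prD (i, s) (den j) = 0].
  have support (p : A) : exists m, forall i s, (m <= s)%N -> prD (i, s) p = 0.
    have [E pE] := prD_finite p; exists (\max_(v <- E) v.2).+1 => i s ms.
    apply: pE; apply: contraL ms => isE; rewrite -ltnNge ltnS.
    by apply: (leq_bigmax_seq _ isE).
  have /choice[num /choice[den frac]] := fun j => phi_frac (e j).
  have /choice[m1 m1P] := fun j => support (num j).
  have /choice[m2 m2P] := fun j => support (den j).
  exists (\max_j maxn (m1 j) (m2 j))%N, num, den => j.
  have [den0 eE] := frac j; split=> // i s ms.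
  have := leq_trans (leq_bigmax (F := fun j => maxn (m1 j) (m2 j)) j) ms.
  by rewrite geq_max => /andP[/m1P-> /m2P->].
pose Z : finType := {i : 'I_n & 'I_(M + mu i)}.
pose Y : finType := {k : 'I_n & 'I_(M + lam k)}.
pose iota (z : Z) : 'I_n * nat := (tag z, val (tagged z)).
have iota_inj : injective iota.
  move=> [i s] [j t] [ij]; rewrite /= in ij; case: _ / ij t => t st.
  by congr existT; apply: val_inj.
have iota_out i s : (forall z, (i, s) != iota z) -> (M + mu i <= s)%N.
  move=> out; rewrite leqNgt; apply/negP => s_lt.
  by have := out (Tagged (fun i => 'I_(M + mu i)) (Ordinal s_lt)); rewrite eqxx.
pose row (y : Y) := differential phi (iter (tagged y) del (u (tag y))).
have row_supp (y : Y) v : (forall z, v != iota z) ->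
    prD v (iter (tagged y) del (u (tag y))) = 0.
  case: y v => k j [i s] /iota_out s_ge /=.
  apply: contraTeq s_ge => /(prD_iter_order hdel prD_del (order_u k i)).
  by rewrite -ltnNge; have := a_le k i; have := ltn_ord j; lia.
have bound : (#|{: 'I_r}| + #|Y| <= #|Z|)%N.
  apply: (@orthogonal_card L _ _ _ (fun i z => w i (phi (prX A (iota z))))
    (fun y z => row y (iota z))) => [c c0|c c0|i y].
  (* A combination of the [w i] vanishing on these coordinates vanishes on the
     transcendence basis, where its values are its coefficients. *)
  - pose wc x := \sum_i c i * w i x.
    have wcD x y : wc (x + y) = wc x + wc y.
      rewrite -big_split; apply: eq_bigr => i _ /=.
      by have [[-> _] _] := wP i; rewrite mulrDr.
    have wcM x y : wc (x * y) = wc x * y + x * wc y.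
      rewrite mulr_suml mulr_sumr -big_split; apply: eq_bigr => i _ /=.
      by have [[_ ->] _] := wP i; ring.
    have wc0 p : (forall i s, (M <= s)%N -> prD (i, s) p = 0) -> wc (phi p) = 0.
      move=> p_supp.
      rewrite (@chain_rule_fin _ _ _ _ phi (fun p => wc (phi p)) _ iota) //.
      + by apply: big1 => z _; rewrite /wc c0 mulr0.
      + by split=> x y; rewrite ?rmorphD ?wcD // rmorphM wcM.
      + by move=> k; apply: big1 => i _; rewrite wC mulr0.
      + by move=> [i s] /iota_out s_ge; apply: p_supp; lia.
    move=> j; have [den0 eE supp] := numdenP j.
    have wcj : wc (e j) = c j.
      rewrite /wc (bigD1 j) //= big1 => [|i ij].
        by rewrite (wP j).2.2 eqxx mulr1 addr0.
      by rewrite (wP i).2.2 (negPf ij) mulr0.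
    have : wc (e j * phi (den j)) = 0.
      rewrite eE divfK // wc0 // => i s Ms; by have [] := supp i s Ms.
    rewrite wcM wcj wc0 => [|i s Ms]; last by have [] := supp i s Ms.
    by rewrite mulr0 addr0 => /eqP; rewrite mulf_eq0 (negPf den0) orbF => /eqP.
  - have Yfree := equations_independent prD_del phiC phi_u phi_ker hD D_phi
      K_char0 (N := fun k => (M + lam k)%N) trdeg_le.
    apply: Yfree; apply/funext => v.
    rewrite sum_scale_eval.
    have [[z ->]|no_z] := pselect (exists z, v = iota z); first exact: c0.
    apply: big1 => y _; rewrite /differential row_supp ?rmorph0 ?mulr0 // => z.
    by apply/eqP => vz; apply: no_z; exists z.
  - under eq_bigr do rewrite mulrC.
    rewrite -(@chain_rule_fin _ _ _ _ phi (fun p => w i (phi p)) _ iota) //.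
      rewrite phi_u; exact: derivation0 (wP i).1.
    exact: row_supp.
have cardS (N : 'I_n -> nat) : #|{: {k : 'I_n & 'I_(N k)}}| = (\sum_k N k)%N.
  rewrite card_tagged sumnE big_map big_enum.
  by apply: eq_bigr => k _; rewrite card_ord.
move: bound; rewrite card_ord !cardS !big_split /= addnCA leq_add2l.
by move=> /leq_trans/(_ mu_le); rewrite addnC leq_add2l.
Qed.

(** * The dimension of a component *)

Lemma idpi_eq0 (R : comPzRingType) (I : ideal R) (x : R) :
  idpi I x = 0 <-> x \in I.
Proof.
by rewrite -[x \in I](f_equal (fun y => y \in I) (subr0 x)) -(idpi_eq I) raddf0.
Qed.

Lemma residue_eq0 (R : comPzRingType) (P : prime_ideal R) (x : R) :
  to_residue P x = 0 <-> x \in P.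
Proof.
rewrite -idpi_eq0; split=> [/eqP|x0]; first by rewrite tofrac_eq0 => /eqP.
by rewrite /to_residue [dompi P x]x0 tofrac0.
Qed.

Lemma fraction_quotient (R : idomainType) (x : {fraction R}) :
  exists a b : R, b != 0 /\ x = tofrac a / tofrac b.
Proof.
elim/quotW: x => y; exists \n_y, \d_y; have d0 := denom_ratioP y; split=> //.
apply: (canRL (mulfK _)); first by rewrite tofrac_eq0.
rewrite -[tofrac \d_y]/(FracField.tofrac _) -[tofrac \n_y]/(FracField.tofrac _).
rewrite !piE; apply/eqmodP; rewrite /= FracField.equivfE.
by rewrite /FracField.mulf !numden_Ratio ?mulf_neq0 ?oner_eq0 // !mulr1 mulrC.
Qed.

Lemma residue_frac (R : comPzRingType) (P : prime_ideal R)
    (x : residue_field P) :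
  exists a b, to_residue P b != 0 /\ x = to_residue P a / to_residue P b.
Proof.
have [a [b [b0 ->]]] := fraction_quotient x; exists (repr a), (repr b).
rewrite /to_residue /dompi.
rewrite [idpi P (repr a)]idpi_repr [idpi P (repr b)]idpi_repr.
by rewrite tofrac_eq0.
Qed.

Section PointEvaluation.
Variables (K : fieldType) (d : K -> K) (n : nat) (u : 'I_n -> diffpoly K n).
Variable P : prime_ideal (sigma_ring d u).

Definition point_eval : {rmorphism diffpoly K n -> residue_field P} :=
  to_residue P \o idpi (diff_ideal d u).

Lemma point_eval_generator k j : point_eval (iter j (dp_deriv d) (u k)) = 0.
Proof.
rewrite /point_eval /= (_ : idpi _ _ = 0) ?rmorph0 //.
apply/idpi_eq0/asboolP.
by exists [:: (1, (k, j))]; rewrite big_seq1 mul1r.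
Qed.

Lemma point_eval_frac x :
  exists a b, point_eval b != 0 /\ x = point_eval a / point_eval b.
Proof.
have [a [b [b0 ->]]] := residue_frac x; exists (repr a), (repr b).
by rewrite /point_eval /= !idpi_repr.
Qed.

Lemma point_eval_ker p : minimal_prime P -> reduced (localization P) ->
  point_eval p = 0 -> exists2 s, point_eval s != 0 &
    in_span (fun kj : 'I_n * nat => iter kj.2 (dp_deriv d) (u kj.1)) (s * p).
Proof.
move=> Pmin Pred /residue_eq0/(generic_annihilator Pmin Pred)[s sP sp0].
exists (repr s).
  apply: contra sP => /eqP/(residue_eq0 P (idpi (diff_ideal d u) (repr s))).
  by rewrite [idpi _ _]idpi_repr.
apply/asboolP/(@idpi_eq0 _ (diff_ideal d u)).
by rewrite idpi_mul idpi_repr; exact: sp0.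
Qed.
End PointEvaluation.

Theorem theorem1p2
  (K : fieldType) (d : K -> K)
  (d_derivation : derivation d) (K_char0 : [pchar K] =i pred0)
  (n : nat) (u : 'I_n -> diffpoly K n)
  (P : prime_ideal (sigma_ring d u))
  (P_component : minimal_prime P)
  (P_generically_reduced : reduced (localization P))
  (r : nat) (P_dim : component_dim P r) :
  (r <= jacobi_number u)%N.
Proof.
pose A := malg_polyring K ('I_n * nat)%type.
apply: (@trdeg_le_jacobi K (residue_field P) (scalar_to_residue P) n A
  (dp_deriv d) u (point_eval P) (fun k i => dp_ord i (u k)) r) => //.
- exact: dp_derivation.
- apply: (@prD_shift_derivation K n A d (dp_deriv d)).
  + exact: dp_derivation.
  + exact: dp_derivC.
  + exact: dp_deriv_pvar.
- exact: point_eval_frac.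
- exact: point_eval_generator.
- by move=> p; exact: point_eval_ker.
- by move=> k i s; exact: dp_ord_ge.
Qed.
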